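(* Let $T \subseteq \mathbb{R}^2$ be a lattice of area $1$ and let $Q \subseteq \mathbb{R}^2$ be a bounded, Lebesgue measurable fundamental domain of $T$. Then there is a constant $C>0$, which may depend on $Q$ and $T$ only, such that for any assignment $z_t \in \{-1,+1\}$, $t \in T$, with corresponding coloring function $$ f(x) = \sum_{t \in T} z_t \chi_Q(x-t), \qquad x \in \mathbb{R}^2, $$ there are arbitrarily large line segments $I \subseteq \mathbb{R}^2$ (that is, for every $\ell>0$ there is such a segment $I$ with $|I| \ge \ell$) such that $f$ is measurable on the straight line supporting $I$ and $$ \left|\int_I f\right| \ge C \sqrt{|I|}. $$
   Context: A lattice $T \subseteq \mathbb{R}^2$ is a discrete additive subgroup of $\mathbb{R}^2$ whose linear span is $\mathbb{R}^2$; its area is its covolume, i.e. the area of a parallelogram spanned by a $\mathbb{Z}$-basis of $T$. A fundamental domain of $T$ is a set $Q \subseteq \mathbb{R}^2$ containing exactly one element from each coset of $T$ in $\mathbb{R}^2$; equivalently, $\mathbb{R}^2 = \bigcup_{t \in T}(t+Q)$ is a partition of $\mathbb{R}^2$. $\chi_Q$ denotes the indicator function of $Q$. $|I|$ denotes the length of the line segment $I$. Measurability on a line and the integral $\int_I f$ are with respect to one-dimensional Lebesgue (arclength) measure. *)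

(* Defs.v *)
From HB Require Import structures.
From mathcomp Require Import all_boot all_order all_algebra.
From mathcomp Require Import all_classical all_reals all_analysis.
From mathcomp Require Import measurable_realfun.
Set Implicit Arguments.
Unset Strict Implicit.
Unset Printing Implicit Defensive.
Import Order.TTheory GRing.Theory Num.Theory.
Import numFieldNormedType.Exports.
Local Open Scope classical_set_scope.
Local Open Scope ring_scope.

(* R with the Lebesgue (not just Borel) sigma-algebra: the domain of
   [completed_lebesgue_measure]. *)
Notation lebesgueTypeR R := (caratheodory_type ((wlength (@idfun R))^*)%mu).

Section Plane.
Context {R : realType}.
Implicit Types (T Q : set (R * R)) (a b : R * R).

(* The library norm on R * R is the sup norm, used only for topology and
   boundedness; lengths are Euclidean. *)
Definition enorm (v : R * R) : R := Num.sqrt (v.1 ^+ 2 + v.2 ^+ 2).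

Definition spans_plane T := forall v : R * R,
  exists n (c : 'I_n -> R) (t : 'I_n -> R * R),
    (forall i, T (t i)) /\ v = \sum_(i < n) c i *: t i.

Definition lattice T :=
  [/\ T 0, (forall s t, T s -> T t -> T (s - t)),
      T `<=` isolated T & spans_plane T].

Definition zbasis T a b :=
  T = [set t | exists m n : int, t = a *~ m + b *~ n] /\
  (forall m n : int, a *~ m + b *~ n = 0 -> m = 0 /\ n = 0).

Definition parallelogram_area a b : R := `|a.1 * b.2 - a.2 * b.1|.

(* Independent of the Z-basis, two of which differ by a matrix of
   determinant 1 or -1. *)
Definition has_area T (A : R) :=
  exists a b, zbasis T a b /\ parallelogram_area a b = A.

Definition fundamental_domain T Q :=
  forall x : R * R, exists! q, Q q /\ T (q - x).

Definition lebesgue_measurable2 : set (set (R * R)) :=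
  completed_algebra_gen (@lebesgue_measure R \x @lebesgue_measure R)%E.

(* When Q is a fundamental domain of T, exactly one term is nonzero, so the
   finitely supported sum is the full sum over T. *)
Definition coloring T Q (z : R * R -> R) (x : R * R) : R :=
  \sum_(t \in T) z t * \1_Q (x - t).

Definition seg_length a b : R := enorm (b - a).

(* Unit-speed parametrization of the line through a != b; it carries Lebesgue
   measure on R to arclength, and `[0, seg_length a b] to the segment. *)
Definition line_param a b (s : R) : R * R :=
  a + (s / seg_length a b) *: (b - a).

Definition measurable_on_line (f : R * R -> R) a b :=
  measurable_fun (setT : set (lebesgueTypeR R))
    (f \o line_param a b : lebesgueTypeR R -> R).

Definition seg_integral (f : R * R -> R) a b : R :=
  \int[@completed_lebesgue_measure R]_(s in `[0, seg_length a b])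
    f (line_param a b s).

End Plane.

(* Main.v *)
Require Import Defs.
From HB Require Import structures.
From mathcomp Require Import all_boot all_order all_algebra.
From mathcomp Require Import all_classical all_reals all_analysis.
From mathcomp Require Import measurable_realfun.
From mathcomp Require Import ring lra zify.
Set Implicit Arguments.
Unset Strict Implicit.
Unset Printing Implicit Defensive.
Import Order.TTheory GRing.Theory Num.Theory.
Import numFieldNormedType.Exports.
Local Open Scope classical_set_scope.
Local Open Scope ring_scope.

(** The proof compares two quadratic forms in the coloring f, cut off to the
    square [-N, N] x [-N, N]. The line energy integrates the square of the integral of
    f along y = m x + c against slope_weight (m) dm dc; the square energy integrates the
    square of the integral of f over the axis-parallel square of side 1 / s and
    lower left corner P against s ^ 2 ds dP. Expanding the squares, both are
    double integrals of f (x, y) f (x', y') against a kernel of (x' - x, y' - y), and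
    the weights are chosen so that the kernels agree:

      K (u, v) = integral over s > 0 of overlap (s u) overlap (s v),

    where overlap (t) = max (0, 1 - |t|) is the autocorrelation of the unit interval.
    For squares this is how K arises ([square_pair_energy]); for lines it works
    because K is homogeneous of degree -1, so K (u, v) = K (1, v / u) / |u|, and 1 / |u|
    is the Jacobian of the slope as a function of the ordinate ([line_pair_energy]).
    Hence the two energies of f are equal ([line_square_identity]): sets with small
    integrals along lines have small integrals over squares of every size.

    Assume that |I_f| < C sqrt |I| for every segment I of length at least l along which f
    is measurable. A line meets the big square in a segment of length at most 4 N,
    so the line energy is at most of the order of N (l ^ 2 + C ^ 2 N)
    ([line_energy_le]). On the other hand, squares of a fixed small side based in a
    tile are mostly contained in it, because the area of Q minus its translate by v
    tends to 0 with v ([translation_continuity]). On such squares f is nearly constant,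
    equal to 1 or -1, so the square energy is at least c N ^ 2, where c depends on the
    scale and hence on Q and T but not on the signs ([square_energy_ge]). The bounds
    contradict each other as soon as C ^ 2 is small compared with c and N is large.

    The tile Q is Lebesgue measurable and may behave badly on some lines. It is
    replaced by a Borel subset; the points lost form a null set, which almost every line
    meets in a null set ([null_lines]), and on those lines f is Lebesgue measurable with
    the same integrals as its Borel version ([graph_seg_integral]). *)

(** * Integrals of nonnegative functions on products *)

Section integration_tools.
Context {R : realType}.
Notation mu := (@lebesgue_measure R).
Local Open Scope ereal_scope.

Lemma measurable_affine (a b : R) : measurable_fun setT (fun x : R => (a * x + b)%R).
Proof. by apply: measurable_funD => //; exact: mulrl_measurable. Qed.

(** For nu the image of |a| times Lebesgue measure under x |-> a x + b, this is
    the change of variables formula on Borel sets; half-open intervals suffice. *)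
Lemma measure_affine_unique (a b : R) (nu : {measure set (measurableTypeR R) -> \bar R}) (A : set (measurableTypeR R)) : (a != 0)%R ->
  (forall X, nu X = `|a|%:E * mu ((fun x => a * x + b)%R @^-1` X)) ->
  measurable A -> mu A = nu A.
Proof.
move=> a0 nuE mA.
have [a_gt0|a_lt0|a_eq0] := ltgtP 0%R a; last by rewrite -a_eq0 eqxx in a0.
all: apply: lebesgue_measure_unique => // _ [[c d]] _ <-; rewrite nuE/=.
- rewrite (_ : _ @^-1` _ = `]((c - b) / a)%R, ((d - b) / a)%R]%classic); last first.
    apply/seteqP; split => x /=; rewrite !in_itv/= ltr_pdivrMr// ler_pdivlMr// => /andP[? ?]; apply/andP; split; lra.
  rewrite !lebesgue_measure_itv/= !lte_fin ltr_pM2r ?invr_gt0// ltrD2r.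
  rewrite gtr0_norm//; case: ifPn => _; last by rewrite mule0.
  by rewrite -!EFinB -EFinM; congr EFin; field.
- rewrite (_ : _ @^-1` _ = `[((d - b) / a)%R, ((c - b) / a)%R[%classic); last first.
    apply/seteqP; split => x /=; rewrite !in_itv/= ltr_ndivlMr// ler_ndivrMr// => /andP[? ?]; apply/andP; split; lra.
  rewrite !lebesgue_measure_itv/= !lte_fin ltr_nM2r ?invr_lt0// ltrD2r.
  rewrite ltr0_norm//; case: ifPn => _; last by rewrite mule0.
  by rewrite -!EFinB -EFinM; congr EFin; field.
Qed.

Lemma ge0_integral_affine (a b : R) (F : R -> \bar R) : (a != 0)%R ->
  measurable_fun setT F -> (forall x, 0 <= F x) ->
  \int[mu]_x F x = `|a|%:E * \int[mu]_x F (a * x + b)%R.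
Proof.
move=> a0 mF F0.
have mphi : measurable_fun (setT : set (measurableTypeR R)) (fun x : measurableTypeR R => (a * x + b)%R : measurableTypeR R).
  exact: measurable_affine.
pose nu := mscale (NngNum (normr_ge0 a)) (measure_function_pushforward__canonical__measure_function_Measure mu mphi).
rewrite (eq_measure_integral nu) //; last first.
  by move=> A mA _; apply: (@measure_affine_unique a b nu).
rewrite ge0_integral_mscale //=.
by rewrite ge0_integral_pushforward.
Qed.

Section product_measure.
Context d1 d2 (T1 : measurableType d1) (T2 : measurableType d2).
Variables (m1 : {sigma_finite_measure set T1 -> \bar R})
  (m2 : {sigma_finite_measure set T2 -> \bar R}).

Lemma product_sigma_finite : sigma_finite setT (m1 \x m2).
Proof.
have /sigma_finiteP[F [coverF mono_F finF]] := sigma_finiteT m1.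
have /sigma_finiteP[G [coverG mono_G finG]] := sigma_finiteT m2.
exists (fun n => F n `*` G n).
  apply/seteqP; split=> // -[x y] _.
  have [i _ Fx] : (\bigcup_n F n) x by rewrite -coverF.
  have [j _ Gy] : (\bigcup_n G n) y by rewrite -coverG.
  exists (maxn i j) => //; split.
    exact: (subsetPset _ _ (mono_F _ _ (leq_maxl i j))).
  exact: (subsetPset _ _ (mono_G _ _ (leq_maxr i j))).
move=> n; have [mF Fy] := finF n; have [mG Gy] := finG n.
by split; [exact: measurableX | rewrite product_measure1E// lte_mul_pinfty ?ge0_fin_numE].
Qed.

(** The sigma-finite structure is bundled with the measure so that products can
    be iterated. *)
Definition sf_prod : {sigma_finite_measure set (T1 * T2)%type -> \bar R} :=
  HB.pack (m1 \x m2) (Measure_isSigmaFinite.Build _ _ _ (m1 \x m2) product_sigma_finite).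

Lemma sf_prodE (A : set T1) (B : set T2) : measurable A -> measurable B ->
  sf_prod (A `*` B) = m1 A * m2 B.
Proof. exact: product_measure1E. Qed.

End product_measure.

Lemma integral_product_mul d1 d2 (T1 : measurableType d1) (T2 : measurableType d2)
  (m1 : {sigma_finite_measure set T1 -> \bar R})
  (m2 : {sigma_finite_measure set T2 -> \bar R}) (f : T1 -> \bar R) (g : T2 -> \bar R) :
  measurable_fun setT f -> measurable_fun setT g ->
  (forall x, 0 <= f x) -> (forall y, 0 <= g y) ->
  \int[sf_prod m1 m2]_z (f z.1 * g z.2) = (\int[m1]_x f x) * (\int[m2]_y g y).
Proof.
move=> mf mg f0 g0.
rewrite fubini_tonelli1; last 2 first.
- by apply: emeasurable_funM; apply: measurableT_comp.
- by move=> z; apply: mule_ge0.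
rewrite /fubini_F /=.
under eq_integral do rewrite ge0_integralZl//.
by rewrite ge0_integralZr//; exact: integral_ge0.
Qed.

Lemma measurable_integral d1 d2 (T1 : measurableType d1) (T2 : measurableType d2)
  (m2 : {sigma_finite_measure set T2 -> \bar R}) (F : T1 -> T2 -> \bar R) :
  measurable_fun setT (fun z : T1 * T2 => F z.1 z.2) -> (forall x y, 0 <= F x y) ->
  measurable_fun setT (fun x => \int[m2]_y F x y).
Proof.
move=> mF F0.
exact: (@measurable_fun_fubini_tonelli_F _ _ _ _ _ m2 (fun z => F z.1 z.2)).
Qed.

Lemma tonelli d1 d2 (T1 : measurableType d1) (T2 : measurableType d2)
  (m1 : {sigma_finite_measure set T1 -> \bar R})
  (m2 : {sigma_finite_measure set T2 -> \bar R}) (F : T1 -> T2 -> \bar R) :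
  measurable_fun setT (fun z : T1 * T2 => F z.1 z.2) -> (forall x y, 0 <= F x y) ->
  \int[m1]_x \int[m2]_y F x y = \int[m2]_y \int[m1]_x F x y.
Proof.
move=> mF F0.
exact: (@fubini_tonelli _ _ _ _ _ m1 m2 (fun z => F z.1 z.2)).
Qed.

Lemma integral_product_iter d1 d2 (T1 : measurableType d1) (T2 : measurableType d2)
  (m1 : {sigma_finite_measure set T1 -> \bar R})
  (m2 : {sigma_finite_measure set T2 -> \bar R}) (F : T1 * T2 -> \bar R) :
  measurable_fun setT F -> (forall z, 0 <= F z) ->
  \int[sf_prod m1 m2]_z F z = \int[m1]_x \int[m2]_y F (x, y).
Proof. by move=> mF F0; rewrite fubini_tonelli1. Qed.

Lemma ge0_integralMl d (T : measurableType d) (m : {measure set T -> \bar R})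
  (c : \bar R) (f : T -> \bar R) : measurable_fun setT f ->
  (forall x, 0 <= f x) -> 0 <= c -> \int[m]_x (c * f x) = c * \int[m]_x f x.
Proof. by move=> mf f0 c0; rewrite ge0_integralZl. Qed.

Lemma integral_indicT d (T : measurableType d) (m : {measure set T -> \bar R})
  (A : set T) : measurable A -> \int[m]_x (\1_A x)%:E = m A.
Proof. by move=> mA; rewrite integral_indic// setIT. Qed.

Lemma le_integralT d (T : measurableType d) (m : {measure set T -> \bar R})
  (f g : T -> \bar R) : measurable_fun setT f -> measurable_fun setT g ->
  (forall x, 0 <= f x) -> (forall x, f x <= g x) ->
  \int[m]_x f x <= \int[m]_x g x.
Proof. by move=> mf mg f0 fg; apply: ge0_le_integral. Qed.

End integration_tools.

(** The tactic [meas] proves measurability by recursion on the shape of the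
    function, using the measurability hypotheses in the context at the leaves.
    Heads are compared syntactically, so that no integral is ever unfolded. *)
Ltac meas_comp h f :=
  match goal with H : measurable_fun _ ?h' |- _ =>
    constr_eq h h'; refine (@measurableT_comp _ _ _ _ _ _ h _ f H _) end.
Ltac meas_comp2 h f g :=
  match goal with
  | H : measurable_fun _ (fun z => ?h' (fst z) (snd z)) |- _ =>
    constr_eq h h'; refine (@measurableT_comp _ _ _ _ _ _
      (fun z => h (fst z) (snd z)) _ (fun z => (f z, g z)) H _); cbv beta
  end.
Ltac meas_comp2' :=
  lazymatch goal with |- measurable_fun _ (fun z => ?h (@?f z) (@?g z)) =>
    meas_comp2 h f g end.
Ltac meas_step :=
  lazymatch goal with
  | |- measurable_fun _ (fun z => z) => exact: measurable_id
  | |- measurable_fun _ (fun z => fst z) => exact: measurable_fst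
  | |- measurable_fun _ (fun z => snd z) => exact: measurable_snd
  | |- measurable_fun _ (fun z => fst (@?f z)) =>
      refine (@measurableT_comp _ _ _ _ _ _ fst _ f measurable_fst _)
  | |- measurable_fun _ (fun z => snd (@?f z)) =>
      refine (@measurableT_comp _ _ _ _ _ _ snd _ f measurable_snd _)
  | |- measurable_fun _ (fun z => mule (@?f z) (@?g z)) =>
      refine (@emeasurable_funM _ _ _ _ f g _ _)
  | |- measurable_fun _ (fun z => pair (@?f z) (@?g z)) =>
      refine (@measurable_fun_pair _ _ _ _ _ _ f g _ _)
  | |- measurable_fun _ (fun z => (@?f z * @?g z)%R) =>
      refine (@measurable_funM _ _ _ _ f g _ _)
  | |- measurable_fun _ (fun z => (@?f z ^+ _)%R) => refine (@measurable_funX _ _ _ _ f _ _)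
  | |- measurable_fun _ (fun z => (- (@?f z))%R) => refine (@measurable_funN _ _ _ _ f _)
  | |- measurable_fun _ (fun z => (@?f z + @?g z)%R) => refine (@measurable_funD _ _ _ _ f g _ _)
  | |- measurable_fun _ (fun z => EFin (@?f z)) => apply/measurable_EFinP
  | |- measurable_fun _ (fun z => ?h (@?f z)) =>
      first [meas_comp h f | meas_comp2' | exact: measurable_cst]
  | H : measurable_fun _ ?h |- measurable_fun _ ?h => exact: H
  | |- measurable_fun _ (fun z => ?c) => exact: measurable_cst
  end.
Ltac meas := repeat (meas_step; cbv beta).

(** * Lines and squares through pairs of points *)

(* Comparing two integrals must not unfold their definition. *)
#[local] Opaque integral.
Section line_square.
Context {R : realType}.
Notation mu := (@lebesgue_measure R).
Notation area := (sf_prod mu mu).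
Notation scaled_area := (sf_prod mu area).
Local Open Scope ereal_scope.

Definition unit_ind (w : R) : \bar R := (\1_(`[0%R, 1%R[%classic : set R) w)%:E.
Definition pos_ind (s : R) : \bar R := (\1_(`]0%R, +oo[%classic : set R) s)%:E.

Lemma measurable_unit_ind : measurable_fun setT unit_ind.
Proof. by apply/measurable_EFinP; apply: measurable_indic. Qed.
Lemma measurable_pos_ind : measurable_fun setT pos_ind.
Proof. by apply/measurable_EFinP; apply: measurable_indic. Qed.
Lemma unit_ind_ge0 w : 0 <= unit_ind w. Proof. by rewrite lee_fin. Qed.
Lemma pos_ind_ge0 w : 0 <= pos_ind w. Proof. by rewrite lee_fin. Qed.

(** Equal to max (0, 1 - |v|): the autocorrelation of the unit interval, hence a
    positive definite function of v. *)
Definition overlap (v : R) : \bar R := \int[mu]_w (unit_ind w * unit_ind (w + v)%R).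

(** A mixture, over the scale 1 / s, of the positive definite functions
    overlap (s u) * overlap (s v); the measure ds makes it homogeneous of
    degree -1. *)
Definition pair_kernel (u v : R) : \bar R :=
  \int[mu]_s (pos_ind s * (overlap (s * u)%R * overlap (s * v)%R)).

(** The restriction of the kernel to u = 1 is the density in the slope with which
    lines have to be counted. *)
Definition slope_weight (m : R) : \bar R := pair_kernel 1 m.

(** For 0 < s, the indicator of the square of side 1 / s whose lower left corner
    is P. *)
Definition corner_box (s : R) (P X : R * R) : \bar R :=
  unit_ind (s * (X.1 - P.1))%R * unit_ind (s * (X.2 - P.2))%R.

Lemma overlap_ge0 v : 0 <= overlap v.
Proof. by apply: integral_ge0 => w _; rewrite mule_ge0 ?unit_ind_ge0. Qed.

Lemma measurable_overlap : measurable_fun setT overlap.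
Proof.
have mU := measurable_unit_ind.
apply: measurable_integral => [|v w]; last by rewrite mule_ge0 ?unit_ind_ge0.
by meas.
Qed.

Lemma measurable_pair_kernel : measurable_fun setT (fun z : R * R => pair_kernel z.1 z.2).
Proof.
have mU := measurable_overlap; have mp := measurable_pos_ind.
apply: measurable_integral => [|v w]; last by rewrite !mule_ge0 ?overlap_ge0 ?pos_ind_ge0.
by meas.
Qed.

Lemma pair_kernel_ge0 u v : 0 <= pair_kernel u v.
Proof. by apply: integral_ge0 => w _; rewrite !mule_ge0 ?overlap_ge0 ?pos_ind_ge0. Qed.

Lemma measurable_slope_weight : measurable_fun setT slope_weight.
Proof. by have mK := measurable_pair_kernel; rewrite /slope_weight; meas. Qed.

Lemma overlapN v : overlap (- v) = overlap v.
Proof.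
have mU := measurable_unit_ind.
rewrite /overlap [LHS](@ge0_integral_affine _ 1 v); last 3 first.
- exact: oner_neq0.
- by meas.
- by move=> w; rewrite mule_ge0 ?unit_ind_ge0.
rewrite normr1 mul1e; apply: eq_integral => w _.
by rewrite mul1r addrK muleC.
Qed.

Lemma unit_indE w : unit_ind w = ((0 <= w < 1)%R%:R)%:E.
Proof. by rewrite /unit_ind indicE mem_setE in_itv. Qed.

Lemma unit_ind_le1 w : unit_ind w <= 1.
Proof. by rewrite unit_indE lee_fin lern1 leq_b1. Qed.

Lemma integral_unit_ind : \int[mu]_w unit_ind w = 1.
Proof.
rewrite integral_indic// setIT [LHS]lebesgue_measure_itv/= lte_fin ltr01.
by rewrite oppr0 adde0.
Qed.

Lemma overlap_le1 v : overlap v <= 1.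
Proof.
have mU := measurable_unit_ind.
rewrite -integral_unit_ind; apply: ge0_le_integral => //.
- by move=> w; rewrite mule_ge0 ?unit_ind_ge0.
- by meas.
- by move=> w; rewrite -[leRHS]mule1 lee_pmul ?unit_ind_ge0 ?unit_ind_le1.
Qed.

Lemma overlap_eq0 v : (1 <= `|v|)%R -> overlap v = 0.
Proof.
move=> v1; rewrite /overlap integral0_eq// => w _.
rewrite !unit_indE -EFinM -natrM mulnb.
case: andP => // -[/andP[? ?] /andP[? ?]]; exfalso.
by move: v1; rewrite leNgt ltr_norml; move/negP; apply; apply/andP; split; lra.
Qed.

Lemma pos_indE s : pos_ind s = ((0 < s)%R%:R)%:E.
Proof. by rewrite /pos_ind indicE mem_setE in_itv/= andbT. Qed.

Lemma overlapE v : overlap v = \int[mu]_w (unit_ind w * unit_ind (w + v)%R).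
Proof. by []. Qed.

Lemma pair_kernelE u v : pair_kernel u v = \int[mu]_s (pos_ind s * (overlap (s * u)%R * overlap (s * v)%R)).
Proof. by []. Qed.

#[local] Opaque overlap unit_ind pos_ind pair_kernel.

(** Substituting w = s (x - p) turns the two conditions on the corner p into those
    that define the overlap. *)
Lemma integral_corner (s x x' : R) : (0 < s)%R ->
  s%:E * \int[mu]_p (unit_ind (s * (x - p))%R * unit_ind (s * (x' - p))%R) =
  overlap (s * (x' - x))%R.
Proof.
move=> s0; have mU := measurable_unit_ind.
rewrite overlapE [RHS](@ge0_integral_affine _ (- s) (s * x)); last 3 first.
- by rewrite oppr_eq0 gt_eqF.
- by meas.
- by move=> w; rewrite mule_ge0 ?unit_ind_ge0.
rewrite normrN (gtr0_norm s0); apply: (congr1 (mule _)); apply: eq_integral => p _.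
have -> : (- s * p + s * x = s * (x - p))%R by ring.
by have -> : (s * (x - p) + s * (x' - x) = s * (x' - p))%R by ring.
Qed.

(** Homogeneity comes from substituting s / |u| for s; the sign of u is absorbed
    by the symmetry of the overlap. *)
Lemma pair_kernel_scale (u v : R) : (u != 0)%R -> pair_kernel u v = `|u|^-1%:E * slope_weight (v / u).
Proof.
move=> u0; have mt := measurable_overlap; have mp := measurable_pos_ind.
rewrite /slope_weight !pair_kernelE [LHS](@ge0_integral_affine _ (`|u|^-1) 0); last 3 first.
- by rewrite invr_eq0 normr_eq0.
- by meas.
- by move=> w; rewrite !mule_ge0 ?overlap_ge0 ?pos_ind_ge0.
have un : (0 <= `|u|^-1)%R by rewrite invr_ge0.
rewrite (ger0_norm un).
apply: (congr1 (mule _)).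
apply: eq_integral => s _.
rewrite (addr0 (`|u|^-1 * s)%R).
have -> : pos_ind (`|u|^-1 * s) = pos_ind s.
  by rewrite !pos_indE pmulr_rgt0// invr_gt0 normr_gt0.
apply: (congr1 (mule _)).
have /orP[u_lt0|u_gt0] : (u < 0)%R || (0 < u)%R by rewrite -neq_lt.
- rewrite (ltr0_norm u_lt0) -[in RHS]overlapN -[in X in _ = _ * X]overlapN.
  have -> : ((- u)^-1 * s * u = - (s * 1))%R by field.
  by have -> : ((- u)^-1 * s * v = - (s * (v / u)))%R by field.
- rewrite (gtr0_norm u_gt0).
  have -> : (u^-1 * s * u = s * 1)%R by field.
  by have -> : (u^-1 * s * v = s * (v / u))%R by field.
Qed.

Lemma tonelli_line (F : R -> R -> \bar R) :
  measurable_fun setT (fun z : R * R => F z.1 z.2) -> (forall x y, 0 <= F x y) ->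
  \int[mu]_x \int[mu]_y F x y = \int[mu]_y \int[mu]_x F x y.
Proof. by move=> mF F0; apply: tonelli. Qed.

Lemma tonelli_plane (F : R * R -> R * R -> \bar R) :
  measurable_fun setT (fun z : (R * R) * (R * R) => F z.1 z.2) -> (forall x y, 0 <= F x y) ->
  \int[area]_x \int[area]_y F x y = \int[area]_y \int[area]_x F x y.
Proof. by move=> mF F0; apply: tonelli. Qed.

Lemma tonelli_scaled (F : R * (R * R) -> R * R -> \bar R) :
  measurable_fun setT (fun z : (R * (R * R)) * (R * R) => F z.1 z.2) -> (forall x y, 0 <= F x y) ->
  \int[scaled_area]_x \int[area]_y F x y = \int[area]_y \int[scaled_area]_x F x y.
Proof. by move=> mF F0; apply: tonelli. Qed.

(** The point w = (m, c) stands for the line y = m x + c. *)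
Definition line_energy (g h : R * R -> \bar R) : \bar R :=
  \int[area]_w (slope_weight w.1 * ((\int[mu]_x g (x, (w.1 * x + w.2)%R)) *
                          (\int[mu]_x h (x, (w.1 * x + w.2)%R)))).

(** The point w = (s, P) stands for the square of side 1 / s with lower left
    corner P; the weight s ^ 2 compensates the two factors 1 / s of
    [integral_corner]. *)
Definition square_energy (g h : R * R -> \bar R) : \bar R :=
  \int[scaled_area]_w (pos_ind w.1 * (w.1 ^+ 2)%:E *
    ((\int[area]_X (g X * corner_box w.1 w.2 X)) * (\int[area]_X (h X * corner_box w.1 w.2 X)))).

(** X collects the two abscissas and Y the two ordinates, since the lines have to
    be integrated for fixed abscissas. *)
Definition pair_energy (g h : R * R -> \bar R) : \bar R :=
  \int[area]_X \int[area]_Y (pair_kernel (X.2 - X.1)%R (Y.2 - Y.1)%R * (g (X.1, Y.1) * h (X.2, Y.2))).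

Lemma corner_box_ge0 s P X : 0 <= corner_box s P X.
Proof. by rewrite mule_ge0 ?unit_ind_ge0. Qed.

Section energies.
Variables g h : R * R -> \bar R.
Hypotheses (mg : measurable_fun setT g) (mh : measurable_fun setT h).
Hypotheses (g0 : forall X, 0 <= g X) (h0 : forall X, 0 <= h X).

(** No line y = m x + c joins two points with the same abscissa; such pairs
    have to be discarded. *)
Lemma diagonal_negligible : area.-negligible [set X : R * R | X.1 = X.2].
Proof.
exists [set X : R * R | X.1 = X.2]; split => //=.
- rewrite (_ : [set _ | _] = (fun X : R * R => X.1 - X.2)%R @^-1` [set 0%R]).
    rewrite -[_ @^-1` _]setTI.
    suff mD : measurable_fun setT (fun X : R * R => X.1 - X.2)%R by exact: mD.
    by meas.
  by apply/seteqP; split => X /=; [move=> ->; rewrite subrr|move/eqP; rewrite subr_eq0 => /eqP].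
- rewrite /product_measure1 integral0_eq// => x _ /=.
  rewrite (_ : xsection _ _ = [set x]); first exact: lebesgue_measure_set1.
  by apply/seteqP; split => y; rewrite /xsection /= in_setE/=.
Qed.

(** For fixed abscissas x <> x' and a fixed ordinate y, the line of slope m
    through (x, y) reaches the ordinate y' = y + m (x' - x) at x'. Replacing dm by
    dy' / |x' - x| produces slope_weight m / |x' - x|, which is the kernel by
    homogeneity. *)
Lemma line_pair_energy : line_energy g h = pair_energy g h.
Proof.
have mr := measurable_slope_weight; have mK := measurable_pair_kernel.
transitivity (\int[area]_w \int[area]_X (slope_weight w.1 *
    (g (X.1, (w.1 * X.1 + w.2)%R) * h (X.2, (w.1 * X.2 + w.2)%R)))).
  apply: eq_integral => w _; rewrite ge0_integralMl; last 3 first.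
  - by meas.
  - by move=> X; rewrite mule_ge0.
  - exact: pair_kernel_ge0.
  congr (_ * _); symmetry.
  by apply: (@integral_product_mul _ _ _ _ _ mu mu (fun x => g (x, w.1 * x + w.2)%R) (fun x => h (x, w.1 * x + w.2)%R)) => //; meas.
rewrite (@tonelli_plane (fun w X => slope_weight w.1 *
    (g (X.1, (w.1 * X.1 + w.2)%R) * h (X.2, (w.1 * X.2 + w.2)%R)))); last 2 first.
- by meas.
- by move=> w X; rewrite !mule_ge0// pair_kernel_ge0.
apply: ge0_ae_eq_integral; first exact: measurableT.
- apply: measurable_integral => [|w X]; last by rewrite !mule_ge0// pair_kernel_ge0.
  by meas.
- apply: measurable_integral => [|w X]; last by rewrite !mule_ge0// pair_kernel_ge0.
  by meas.
- by move=> X _; apply: integral_ge0 => w _; rewrite !mule_ge0// pair_kernel_ge0.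
- by move=> X _; apply: integral_ge0 => w _; rewrite !mule_ge0// pair_kernel_ge0.
apply: negligibleS diagonal_negligible => -[x x'] /= /not_implyP[_].
apply: contra_notP => /eqP xx'.
have u0 : (x' - x != 0)%R by rewrite subr_eq0 eq_sym.
rewrite integral_product_iter; last 2 first.
- by meas.
- by move=> w; rewrite !mule_ge0// pair_kernel_ge0.
rewrite /=.
transitivity (\int[mu]_m \int[mu]_y (slope_weight m * (g (x, y) * h (x', (y + m * (x' - x))%R)))).
  apply: eq_integral => m _.
  rewrite [RHS](@ge0_integral_affine _ 1 (m * x)); last 3 first.
  - exact: oner_neq0.
  - by meas.
  - by move=> w; rewrite !mule_ge0// pair_kernel_ge0.
  rewrite normr1 mul1e; apply: eq_integral => c _.
  congr (_ * (g (_ , _) * h (_, _))); ring.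
rewrite (@tonelli_line (fun m y =>
    slope_weight m * (g (x, y) * h (x', (y + m * (x' - x))%R)))); last 2 first.
- by meas.
- by move=> w X; rewrite !mule_ge0// pair_kernel_ge0.
rewrite integral_product_iter; last 2 first.
- by meas.
- by move=> w; rewrite !mule_ge0// pair_kernel_ge0.
apply: eq_integral => y _ /=.
rewrite [RHS](@ge0_integral_affine _ (x' - x) y); last 3 first.
- exact: u0.
- by meas.
- by move=> w; rewrite !mule_ge0// pair_kernel_ge0.
rewrite -ge0_integralMl; last 3 first.
- by meas.
- by move=> w; rewrite !mule_ge0// pair_kernel_ge0.
- by rewrite lee_fin.
apply: eq_integral => m _.
rewrite pair_kernel_scale// !muleA -EFinM divff ?normr_eq0// mul1e.
rewrite addrK mulrAC divff// mul1r [(_ + y)%R]addrC [(m * _)%R]mulrC//.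
Qed.

Ltac nneg := do ?apply: mule_ge0; lazymatch goal with
  | |- context [corner_box] => exact: corner_box_ge0
  | |- context [pos_ind] => exact: pos_ind_ge0
  | |- context [unit_ind] => exact: unit_ind_ge0
  | |- context [EFin] => rewrite lee_fin; exact: sqr_ge0
  | |- _ => first [exact: g0 | exact: h0]
  end.

(** For fixed s the two coordinates of the corner separate, and each of them
    contributes one overlap by [integral_corner]. *)
Lemma square_pair_energy : square_energy g h = pair_energy g h.
Proof.
have mU := measurable_unit_ind; have mp := measurable_pos_ind.
have mK := measurable_pair_kernel.
have F0 w x x' y y' : 0 <= pos_ind w.1 * (w.1 ^+ 2)%:E *
    ((g (x, y) * corner_box w.1 w.2 (x, y)) * (h (x', y') * corner_box w.1 w.2 (x', y'))).
  by nneg.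
transitivity (\int[scaled_area]_w \int[area]_X \int[area]_Y
   (pos_ind w.1 * (w.1 ^+ 2)%:E *
    ((g (X.1, Y.1) * corner_box w.1 w.2 (X.1, Y.1)) * (h (X.2, Y.2) * corner_box w.1 w.2 (X.2, Y.2))))).
  apply: eq_integral => w _.
  transitivity (\int[area]_X (pos_ind w.1 * (w.1 ^+ 2)%:E * \int[area]_Y
    ((g (X.1, Y.1) * corner_box w.1 w.2 (X.1, Y.1)) * (h (X.2, Y.2) * corner_box w.1 w.2 (X.2, Y.2))))); last first.
    apply: eq_integral => X _; rewrite ge0_integralMl.
    - by [].
    - by rewrite /corner_box; meas.
    - by move=> Y; nneg.
    - by nneg.
  rewrite ge0_integralMl; last 3 first.
  - apply: measurable_integral => [|X Y]; last by nneg.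
    by rewrite /corner_box; meas.
  - by move=> X; apply: integral_ge0 => Y _; nneg.
  - nneg.
  congr (_ * _).
  rewrite [X in X * _ = _]integral_product_iter; [|by rewrite /corner_box; meas|by move=> X; nneg].
  rewrite [X in _ * X = _]integral_product_iter; [|by rewrite /corner_box; meas|by move=> X; nneg].
  rewrite -integral_product_mul; last 4 first.
  - apply: measurable_integral => [|x y]; last by nneg.
    by rewrite /corner_box; meas.
  - apply: measurable_integral => [|x y]; last by nneg.
    by rewrite /corner_box; meas.
  - by move=> x; apply: integral_ge0 => y _; nneg.
  - by move=> x; apply: integral_ge0 => y _; nneg.
  apply: eq_integral => X _; symmetry.
  apply: (@integral_product_mul _ _ _ _ _ mu mu (fun y => g (X.1, y) * corner_box w.1 w.2 (X.1, y))
    (fun y => h (X.2, y) * corner_box w.1 w.2 (X.2, y))) => //.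
  - by rewrite /corner_box; meas.
  - by rewrite /corner_box; meas.
  - by move=> y; nneg.
  - by move=> y; nneg.
rewrite (@tonelli_scaled (fun w X => \int[area]_Y
   (pos_ind w.1 * (w.1 ^+ 2)%:E *
    ((g (X.1, Y.1) * corner_box w.1 w.2 (X.1, Y.1)) * (h (X.2, Y.2) * corner_box w.1 w.2 (X.2, Y.2)))))); last 2 first.
- apply: measurable_integral => [|z Y]; last exact: F0.
  by rewrite /corner_box; meas.
- by move=> w X; apply: integral_ge0 => Y _; exact: F0.
apply: eq_integral => X _.
rewrite (@tonelli_scaled (fun w Y =>
   (pos_ind w.1 * (w.1 ^+ 2)%:E *
    ((g (X.1, Y.1) * corner_box w.1 w.2 (X.1, Y.1)) * (h (X.2, Y.2) * corner_box w.1 w.2 (X.2, Y.2)))))); last 2 first.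
- by rewrite /corner_box; meas.
- by move=> w Y; exact: F0.
apply: eq_integral => Y _.
transitivity (\int[scaled_area]_w ((g (X.1, Y.1) * h (X.2, Y.2)) * 
  (pos_ind w.1 * (w.1 ^+ 2)%:E * (corner_box w.1 w.2 (X.1, Y.1) * corner_box w.1 w.2 (X.2, Y.2))))).
  by apply: eq_integral => w _; rewrite [RHS]muleCA [X in _ = _ * X]muleACA.
rewrite ge0_integralMl; last 3 first.
- by rewrite /corner_box; meas.
- by move=> w; nneg.
- by nneg.
rewrite muleC; congr (_ * _).
rewrite integral_product_iter; last 2 first.
- by rewrite /corner_box; meas.
- by move=> w; nneg.
apply: eq_integral => s _ /=.
rewrite ge0_integralMl; last 3 first.
- by rewrite /corner_box; meas.
- by move=> P; nneg.
- nneg.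
rewrite -muleA pos_indE.
have [s0|s0] := ltP 0%R s; last by rewrite !mul0e.
rewrite !mul1e.
rewrite -!integral_corner// muleACA -EFinM -expr2; congr (_ * _).
rewrite /corner_box/= -integral_product_mul; last 4 first.
- by meas.
- by meas.
- by move=> p; nneg.
- by move=> p; nneg.
by apply: eq_integral => P _; rewrite muleACA.
Qed.
End energies.
End line_square.

(** * Chords and square masses of plane sets *)

Section chords.
Context {R : realType}.
Notation mu := (@lebesgue_measure R).
Notation area := (sf_prod mu mu).
Notation scaled_area := (sf_prod mu area).
Local Open Scope ereal_scope.

(** Energies of differences reduce to energies of nonnegative functions, for
    which Tonelli's theorem needs no integrability. *)
Lemma polarization d (T : measurableType d) (m : {measure set T -> \bar R})
  (w : T -> \bar R) (a b : T -> R) :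
  measurable_fun setT w -> (forall x, 0 <= w x) ->
  measurable_fun setT a -> (forall x, 0 <= a x)%R ->
  measurable_fun setT b -> (forall x, 0 <= b x)%R ->
  \int[m]_x (w x * ((a x * a x)%:E)) + \int[m]_x (w x * ((b x * b x)%:E)) =
  \int[m]_x (w x * (((a x - b x) ^+ 2)%:E)) + 2%:E * \int[m]_x (w x * ((a x * b x)%:E)).
Proof.
move=> mw w0 ma a0 mb b0.
have mM (f g : T -> R) : measurable_fun setT f -> measurable_fun setT g ->
   measurable_fun setT (fun x => w x * (f x * g x)%:E).
  move=> mf mg; apply: emeasurable_funM => //; apply/measurable_EFinP.
  exact: measurable_funM.
have mD : measurable_fun setT (fun x => w x * ((a x - b x) ^+ 2)%:E).
  by apply: mM; exact: measurable_funB.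
have wM x (r : R) : (0 <= r)%R -> 0 <= w x * r%:E by move=> r0; rewrite mule_ge0.
rewrite -ge0_integralZl//; last 2 first.
- exact: mM.
- by move=> x _; rewrite wM// mulr_ge0.
rewrite -!ge0_integralD//; last 7 first.
- by move=> x _; rewrite wM// sqr_ge0.
- by move=> x _; rewrite mule_ge0 ?wM// mulr_ge0.
- by apply: emeasurable_funM => //; exact: mM.
- by move=> x _; rewrite wM// mulr_ge0.
- exact: mM.
- by move=> x _; rewrite wM// mulr_ge0.
- exact: mM.
apply: eq_integral => x _.
rewrite [2%:E * _]muleCA -EFinM -!ge0_muleDr ?lee_fin ?sqr_ge0 ?mulr_ge0//.
by rewrite -!EFinD; congr (_ * EFin _); ring.
Qed.

(** Measured along the abscissa axis: shorter than arclength by the factor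
    sqrt (1 + m ^ 2). *)
Definition chord (A : set (R * R)) (w : R * R) : R :=
  fine (mu [set x | A (x, w.1 * x + w.2)%R]).

Definition corner_square (s : R) (P : R * R) : set (R * R) :=
  [set X | (0 <= s * (X.1 - P.1) < 1)%R && (0 <= s * (X.2 - P.2) < 1)%R].

Definition square_mass (A : set (R * R)) (w : R * (R * R)) : R :=
  fine (area (A `&` corner_square w.1 w.2)).

Definition big_square (N : R) : set (R * R) := [set X | (`|X.1| <= N)%R /\ (`|X.2| <= N)%R].

Lemma measurable_line (A : set (R * R)) (m c : R) : measurable A ->
  measurable [set x | A (x, m * x + c)%R].
Proof.
move=> mA; rewrite -[X in measurable X]setTI.
have mf : measurable_fun setT (fun x : R => (x, m * x + c)%R) by meas.
exact: mf.
Qed.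

Lemma measurable_big_square N : measurable (big_square N).
Proof.
rewrite (_ : big_square N = `[(-N)%R, N]%classic `*` `[(-N)%R, N]%classic).
  exact: measurableX.
by apply/seteqP; split => -[x y]; rewrite /big_square/= !in_itv/= !ler_norml => -[].
Qed.

Lemma area_big_square (N : R) : (0 <= N)%R -> area (big_square N) = ((2 * N) ^+ 2)%:E.
Proof.
move=> N0; rewrite (_ : big_square N = `[(-N)%R, N]%classic `*` `[(-N)%R, N]%classic); last first.
  by apply/seteqP; split => -[x y]; rewrite /big_square/= !in_itv/= !ler_norml => -[].
rewrite sf_prodE//= lebesgue_measure_itv/= lte_fin.
case: ltP => [_|NN].
  by rewrite -EFinB -EFinM; congr EFin; ring.
by rewrite mule0 (_ : N = 0)%R; [rewrite mulr0 expr0n|lra].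
Qed.

Lemma mu_interval (a b : R) : mu `[a, b] = (Num.max (b - a) 0)%:E.
Proof.
rewrite lebesgue_measure_itv/= lte_fin; case: ltP => ab.
  by rewrite -EFinB max_l// subr_ge0 ltW.
by rewrite max_r// subr_le0.
Qed.

Section bounded.
Variables (A : set (R * R)) (N : R).
Hypotheses (mA : measurable A) (AN : A `<=` big_square N) (N0 : (0 < N)%R).

Lemma line_measure_le (m c : R) : mu [set x | A (x, m * x + c)%R] <= (2 * N)%:E.
Proof.
have Np := N0.
rewrite (_ : 2 * N = Num.max (N - - N) 0)%R -?mu_interval; last first.
  by rewrite max_l; lra.
apply: le_measure; rewrite ?inE//; first exact: measurable_line.
by move=> x /AN[/=]; rewrite in_itv/= ler_norml.
Qed.

(** While the ordinate stays in [-N, N], the abscissa moves by at most 2 N / |m|. *)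
Lemma line_measure_le_slope (m c : R) : `|m|%:E * mu [set x | A (x, m * x + c)%R] <= (2 * N)%:E.
Proof.
have Np := N0.
have [->|m0] := eqVneq m 0%R; first by rewrite normr0 mul0e lee_fin; lra.
have mm0 : (0 < `|m|)%R by rewrite normr_gt0.
rewrite -lee_pdivlMl// -EFinM.
rewrite (_ : _ * _ = Num.max ((- c / m + N / `|m|) - (- c / m - N / `|m|)) 0)%R -?mu_interval; last first.
  rewrite max_l; first by field; rewrite gt_eqF//.
  by have : (0 <= N / `|m|)%R; [rewrite mulr_ge0// ?invr_ge0 ltW|lra].
apply: le_measure; rewrite ?inE//; first exact: measurable_line.
move=> x /AN[/= _]; rewrite in_itv/= -ler_distl.
rewrite (_ : m * x + c = m * (x - (- c / m)))%R; last by field.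
by rewrite normrM -ler_pdivlMl// [(N / _)%R]mulrC.
Qed.

Lemma line_measureE w : mu [set x | A (x, w.1 * x + w.2)%R] = (chord A w)%:E.
Proof.
rewrite fineK// ge0_fin_numE//; apply: le_lt_trans (line_measure_le _ _) _.
exact: ltry.
Qed.

Lemma chord_ge0 w : (0 <= chord A w)%R. Proof. exact: fine_ge0. Qed.

Lemma chord_le w : (chord A w <= 2 * N)%R.
Proof. by rewrite -lee_fin -line_measureE line_measure_le. Qed.

Lemma chord_sqr_le w : ((1 + w.1 ^+ 2) * chord A w ^+ 2 <= 8 * N ^+ 2)%R.
Proof.
have Np := N0.
have h1 := chord_le w; have h0 := chord_ge0 w.
have h2 : (`|w.1| * chord A w <= 2 * N)%R.
  by rewrite -lee_fin EFinM -line_measureE line_measure_le_slope.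
rewrite -real_normK ?num_real//.
have : (chord A w ^+ 2 <= (2 * N) ^+ 2)%R by rewrite lerXn2r// nnegrE; lra.
have : ((`|w.1| * chord A w) ^+ 2 <= (2 * N) ^+ 2)%R.
  by rewrite lerXn2r ?nnegrE//; [rewrite mulr_ge0|lra].
by nra.
Qed.

Lemma chord_eq0 w : (N * (1 + `|w.1|) < `|w.2|)%R -> chord A w = 0%R.
Proof.
have Np := N0.
move=> cN; rewrite /chord (_ : [set x | _] = set0) ?measure0//.
rewrite -subset0 => x /AN[/= xN yN]; move: cN; rewrite ltNge => /negP; apply.
rewrite (_ : w.2 = (w.1 * x + w.2) - w.1 * x)%R; last by ring.
rewrite (le_trans (ler_normB _ _))// normrM.
have : (`|w.1| * `|x| <= `|w.1| * N)%R by rewrite ler_wpM2l.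
by nra.
Qed.

Lemma measurable_chord : measurable_fun setT (chord A).
Proof.
apply: measurableT_comp; first exact: fine_measurable.
rewrite (_ : (fun w => _) = (fun w : R * R => \int[mu]_x (\1_A (x, (w.1 * x + w.2)%R))%:E)).
  apply: measurable_integral => [|w x]; last by rewrite lee_fin.
  have mi : measurable_fun setT (\1_A : R * R -> R) by apply: measurable_indic.
  apply/measurable_EFinP; apply: (measurableT_comp mi); by meas.
apply/funext => w.
rewrite -(integral_indicT mu (measurable_line w.1 w.2 mA)).
by apply: eq_integral => x _; rewrite !indicE.
Qed.

End bounded.

Lemma slope_weight_le1 (m : R) : slope_weight m <= 1.
Proof.
rewrite -(@integral_unit_ind R); have mt := @measurable_overlap R; have mp := @measurable_pos_ind R.
have mU := @measurable_unit_ind R.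
rewrite /slope_weight pair_kernelE; apply: le_integralT.
- by meas.
- by meas.
- by move=> s; rewrite !mule_ge0 ?overlap_ge0 ?pos_ind_ge0.
move=> s; rewrite mulr1 pos_indE unit_indE.
have [s0|s0] := ltP 0%R s; last by rewrite mul0e lee_fin.
have [s1|s1] := ltP s 1%R; last by rewrite overlap_eq0 ?mul0e ?mule0 ?lee_fin// ger0_norm// ltW.
rewrite mul1e (ltW s0)/= -[leRHS]mule1; apply: lee_pmul; rewrite ?overlap_ge0 ?overlap_le1//.
Qed.

Lemma pair_kernelC (u v : R) : pair_kernel u v = pair_kernel v u.
Proof. by apply: eq_integral => s _; rewrite [overlap _ * _]muleC. Qed.

(** The kernel is symmetric, so slope_weight m = slope_weight (1 / m) / |m|:
    steep lines are flat lines with the axes exchanged. *)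
Lemma slope_weight_decay (m : R) : slope_weight m * (1 + `|m|)%:E <= 2%:E.
Proof.
rewrite EFinD ge0_muleDr ?lee_fin// mule1.
suff h : slope_weight m * `|m|%:E <= 1.
  by rewrite (_ : 2%:E = 1 + 1)//; rewrite leeD ?slope_weight_le1.
have [->|m0] := eqVneq m 0%R; first by rewrite normr0 mule0 lee_fin.
rewrite /slope_weight pair_kernelC pair_kernel_scale// muleC muleA -EFinM divff ?normr_eq0// mul1e.
exact: slope_weight_le1.
Qed.

Lemma measurable_cauchy : measurable_fun setT (fun m : R => (1 + m ^+ 2)^-1)%R.
Proof. by apply: continuous_measurable_fun; exact: continuous_oneDsqrV. Qed.

Lemma integral_cauchy : \int[mu]_m ((1 + m ^+ 2)^-1)%:E = (pi : R)%:E.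
Proof.
rewrite (@ge0_symfun_integralT _ (fun m => (1 + m ^+ 2)^-1)%R).
- rewrite -set_itvcy integral0y_oneDsqr -EFinM; congr EFin; by field.
- by move=> x; rewrite invr_ge0; apply: addr_ge0 => //; exact: sqr_ge0.
- exact: continuous_oneDsqrV.
- by move=> x /=; rewrite sqrrN.
Qed.

Lemma measurable_line_mass (N D : R) : measurable_fun setT (fun w : R * R =>
  slope_weight w.1 * (((`|w.2| <= N * (1 + `|w.1|))%R%:R * (D / (1 + w.1 ^+ 2)))%R)%:E).
Proof.
have mr := @measurable_slope_weight R; have mc := measurable_cauchy.
have mnorm := @normr_measurable R setT.
have mI : measurable_fun setT (fun w : R * R => (`|w.2| <= N * (1 + `|w.1|))%R%:R : R).
  rewrite (_ : (fun _ => _) = \1_[set w : R * R | (`|w.2| <= N * (1 + `|w.1|))%R]); last first.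
    by apply/funext => w; rewrite indicE mem_setE.
  apply: measurable_indic. rewrite -[X in measurable X]setTI.
  apply: (@measurable_fun_ler _ _ _ setT (fun w : R * R => `|w.2|%R) (fun w => N * (1 + `|w.1|))%R _ _ measurableT [set true]) => //.
  - by meas.
  - by meas.
have mc1 : measurable_fun setT (fun w : R * R => (1 + w.1 ^+ 2)^-1)%R.
  exact: (@measurableT_comp _ _ _ _ _ _ _ _ _ mc measurable_fst).
apply: emeasurable_funM; first by meas.
apply/measurable_EFinP; apply: measurable_funM; first exact: mI.
by apply: measurable_funM.
Qed.

(** The lines of slope m that meet the big square have |c| <= N (1 + |m|). This
    growth is compensated by the decay of the weight, which leaves the Cauchy
    density in m. *)
Lemma line_mass_le (N D : R) : (0 < N)%R -> (0 <= D)%R ->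
  \int[area]_w (slope_weight w.1 * (((`|w.2| <= N * (1 + `|w.1|))%R%:R * (D / (1 + w.1 ^+ 2)))%R)%:E)
  <= (4 * N * D * pi)%:E.
Proof.
move=> N0 D0; have mr := @measurable_slope_weight R; have mc := measurable_cauchy.
have D1 (m : R) : (0 <= D / (1 + m ^+ 2))%R by apply: divr_ge0 => //; apply: addr_ge0 => //; exact: sqr_ge0.
have mF := measurable_line_mass N D.
rewrite integral_product_iter; last 2 first.
- exact: mF.
- by move=> w; rewrite mule_ge0 ?pair_kernel_ge0// lee_fin mulr_ge0.
rewrite [leRHS]EFinM -integral_cauchy -ge0_integralZl//; last 3 first.
- exact/measurable_EFinP.
- by move=> m _; rewrite lee_fin invr_ge0; apply: addr_ge0 => //; exact: sqr_ge0.
- by rewrite lee_fin !mulr_ge0// ltW.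
apply: le_integralT.
- apply: measurable_integral => [|m c]; last by rewrite mule_ge0 ?pair_kernel_ge0// lee_fin mulr_ge0.
  exact: mF.
- apply: emeasurable_funM; [exact: measurable_cst|exact/measurable_EFinP].
- by move=> m; apply: integral_ge0 => c _; rewrite mule_ge0 ?pair_kernel_ge0// lee_fin mulr_ge0.
move=> m /=.
set I := `[(- (N * (1 + `|m|)))%R, (N * (1 + `|m|))%R]%classic.
have -> : \int[mu]_c (slope_weight m * ((`|c| <= N * (1 + `|m|))%R%:R * (D / (1 + m ^+ 2)))%:E) =
  \int[mu]_c ((slope_weight m * (D / (1 + m ^+ 2))%:E) * (\1_I c)%:E).
  apply: eq_integral => c _; rewrite indicE mem_setE in_itv/= -ler_norml.
  by rewrite -muleA EFinM [X in _ * X]muleC.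
rewrite ge0_integralMl; last 3 first.
- by apply/measurable_EFinP; apply: measurable_indic; exact: measurable_itv.
- by move=> c; rewrite lee_fin.
- by apply: mule_ge0; [exact: pair_kernel_ge0|rewrite lee_fin; exact: D1].
rewrite integral_indicT; last exact: measurable_itv.
rewrite [X in _ * X]mu_interval.
have Nm : (0 <= N * (1 + `|m|))%R by rewrite mulr_ge0 ?addr_ge0// ltW.
rewrite max_l; last by lra.
rewrite (_ : (N * (1 + `|m|) - - (N * (1 + `|m|))) = (1 + `|m|) * (2 * N))%R; last by ring.
rewrite -muleA -EFinM.
have -> : (D / (1 + m ^+ 2) * ((1 + `|m|) * (2 * N)) =
           (1 + `|m|) * (D / (1 + m ^+ 2) * (2 * N)))%R by ring.
have -> : (4 * N * D)%:E * ((1 + m ^+ 2)^-1)%:E = 2%:E * (D / (1 + m ^+ 2) * (2 * N))%:E.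
  by rewrite -!EFinM; congr EFin; ring.
rewrite EFinM muleA; apply: lee_wpmul2r; last exact: slope_weight_decay.
by rewrite lee_fin mulr_ge0// mulr_ge0// ltW.
Qed.

Lemma corner_boxE s P X : corner_box s P X = (\1_(corner_square s P) X)%:E :> \bar R.
Proof.
rewrite /corner_box !unit_indE -EFinM -natrM mulnb indicE.
by have -> : (X \in corner_square s P) = (0 <= s * (X.1 - P.1) < 1)%R && (0 <= s * (X.2 - P.2) < 1)%R
  by apply/idP/idP; rewrite inE.
Qed.

Lemma measurable_corner_square s P : measurable (corner_square s P : set (R * R)).
Proof.
rewrite (_ : corner_square s P = (fun X : R * R => (s * (X.1 - P.1))%R) @^-1` `[0%R, 1%R[ `&`
                          (fun X : R * R => (s * (X.2 - P.2))%R) @^-1` `[0%R, 1%R[); last first.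
  apply/seteqP; split => X; rewrite /corner_square/= !in_itv/=.
    by move=> /andP[].
  by move=> [-> ->].
apply: measurableI; rewrite -[X in measurable X]setTI.
- have mf : measurable_fun setT (fun X : R * R => (s * (X.1 - P.1))%R) by meas.
  exact: mf.
- have mf : measurable_fun setT (fun X : R * R => (s * (X.2 - P.2))%R) by meas.
  exact: mf.
Qed.

Section cells.
Variables (A : set (R * R)) (N : R).
Hypotheses (mA : measurable A) (AN : A `<=` big_square N) (N0 : (0 < N)%R).

Lemma square_massE w : (square_mass A w)%:E = \int[area]_X ((\1_A X)%:E * corner_box w.1 w.2 X).
Proof.
have mAB : measurable (A `&` corner_square w.1 w.2) by apply: measurableI => //; exact: measurable_corner_square.
have -> : \int[area]_X ((\1_A X)%:E * corner_box w.1 w.2 X) = area (A `&` corner_square w.1 w.2).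
  rewrite -(integral_indicT area mAB); apply: eq_integral => X _.
  by rewrite corner_boxE -EFinM indicI.
rewrite fineK// ge0_fin_numE//.
have : area (A `&` corner_square w.1 w.2) <= area (big_square N).
  apply: le_measure; rewrite ?inE//; last by move=> X [/AN].
  exact: measurable_big_square.
by move=> /le_lt_trans; apply; rewrite area_big_square ?ltry// ltW.
Qed.

Lemma square_mass_ge0 w : (0 <= square_mass A w)%R. Proof. exact: fine_ge0. Qed.

Lemma measurable_square_mass : measurable_fun setT (square_mass A).
Proof.
apply/measurable_EFinP.
rewrite (_ : _ \o _ = (fun w => \int[area]_X ((\1_A X)%:E * corner_box w.1 w.2 X))); last first.
  by apply/funext => w /=; rewrite square_massE.
have mU := @measurable_unit_ind R.
apply: measurable_integral => [|w X]; last by rewrite mule_ge0 ?corner_box_ge0// lee_fin.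
apply: emeasurable_funM; last by rewrite /corner_box; meas.
have mi : measurable_fun setT (\1_A : R * R -> R) by apply: measurable_indic.
by apply/measurable_EFinP; apply: (measurableT_comp mi); meas.
Qed.

End cells.

Section identity.
Variables (A B : set (R * R)) (N : R).
Hypotheses (mA : measurable A) (AN : A `<=` big_square N).
Hypotheses (mB : measurable B) (BN : B `<=` big_square N) (N0 : (0 < N)%R).

Lemma integral_chord w : \int[mu]_x (\1_A (x, (w.1 * x + w.2)%R))%:E = (chord A w)%:E.
Proof.
rewrite -(line_measureE mA AN N0) -(integral_indicT mu (measurable_line w.1 w.2 mA)).
by apply: eq_integral => x _; rewrite !indicE.
Qed.

End identity.

(** Both sides are the pair energy of the indicators of A and B. *)
Lemma chord_square_energy (A B : set (R * R)) (N : R) :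
  measurable A -> measurable B -> A `<=` big_square N -> B `<=` big_square N -> (0 < N)%R ->
  \int[area]_w (slope_weight w.1 * ((chord A w * chord B w)%:E)) =
  \int[scaled_area]_w (pos_ind w.1 * (w.1 ^+ 2)%:E * ((square_mass A w * square_mass B w)%:E)).
Proof.
move=> mA mB AN BN N0.
have mi C : measurable C -> measurable_fun setT (fun X : R * R => (\1_C X)%:E : \bar R).
  by move=> mC; apply/measurable_EFinP; exact: measurable_indic.
have i0 C (X : R * R) : 0 <= (\1_C X)%:E :> \bar R by rewrite lee_fin.
transitivity (line_energy (fun X => (\1_A X)%:E) (fun X => (\1_B X)%:E)).
  apply: eq_integral => w _; apply: (congr1 (mule _)).
  by rewrite EFinM (integral_chord mA AN N0) (integral_chord mB BN N0).
rewrite (line_pair_energy (mi _ mA) (mi _ mB) (i0 A) (i0 B)).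
rewrite -(square_pair_energy (mi _ mA) (mi _ mB) (i0 A) (i0 B)).
apply: eq_integral => w _; apply: (congr1 (mule _)).
by rewrite EFinM (square_massE mA AN N0) (square_massE mB BN N0).
Qed.

Lemma chord_mul_le (A B : set (R * R)) (N : R) w :
  measurable A -> measurable B -> A `<=` big_square N -> B `<=` big_square N -> (0 < N)%R ->
  (chord A w * chord B w <= (`|w.2| <= N * (1 + `|w.1|))%R%:R * (8 * N ^+ 2 / (1 + w.1 ^+ 2)))%R.
Proof.
move=> mA mB AN BN N0; have [wN|wN] := lerP `|w.2|%R (N * (1 + `|w.1|))%R; last by rewrite (chord_eq0 AN N0 wN) !mul0r.
have s0 : (0 < 1 + w.1 ^+ 2)%R by apply: ltr_pwDl => //; exact: sqr_ge0.
rewrite mul1r ler_pdivlMr//.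
have := chord_sqr_le mA AN N0 w; have := chord_sqr_le mB BN N0 w.
have : (0 <= (1 + w.1 ^+ 2) * (chord A w - chord B w) ^+ 2)%R.
  by apply: mulr_ge0; [exact: ltW|exact: sqr_ge0].
by nra.
Qed.

Lemma chord_energy_fin (A B : set (R * R)) (N : R) :
  measurable A -> measurable B -> A `<=` big_square N -> B `<=` big_square N -> (0 < N)%R ->
  \int[area]_w (slope_weight w.1 * ((chord A w * chord B w)%:E)) < +oo.
Proof.
move=> mA mB AN BN N0.
have D0 : (0 <= 8 * N ^+ 2)%R by apply: mulr_ge0 => //; exact: sqr_ge0.
apply: le_lt_trans (ltry (4 * N * (8 * N ^+ 2) * pi)).
apply: le_trans (line_mass_le N0 D0).
have mr := @measurable_slope_weight R.
have mcA := measurable_chord mA; have mcB := measurable_chord mB.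
apply: le_integralT.
- by meas.
- exact: measurable_line_mass.
- by move=> w; rewrite mule_ge0 ?pair_kernel_ge0// lee_fin mulr_ge0 ?chord_ge0.
- move=> w; apply: lee_wpmul2l; first exact: pair_kernel_ge0.
  by rewrite lee_fin; exact: chord_mul_le.
Qed.

(** By [polarization] the two sides differ by energies of pairs of sets, which
    agree by [chord_square_energy]; the cross term is finite and cancels. *)
Lemma line_square_identity (A B : set (R * R)) (N : R) :
  measurable A -> measurable B -> A `<=` big_square N -> B `<=` big_square N -> (0 < N)%R ->
  \int[area]_w (slope_weight w.1 * ((chord A w - chord B w) ^+ 2)%:E) =
  \int[scaled_area]_w (pos_ind w.1 * (w.1 ^+ 2)%:E * ((square_mass A w - square_mass B w) ^+ 2)%:E).
Proof.
move=> mA mB AN BN N0.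
have mr := @measurable_slope_weight R; have mp := @measurable_pos_ind R.
have mcA := measurable_chord mA; have mcB := measurable_chord mB.
have mwA := measurable_square_mass mA AN N0; have mwB := measurable_square_mass mB BN N0.
have w0 (s : R) : 0 <= pos_ind s * (s ^+ 2)%:E.
  by apply: mule_ge0; [exact: pos_ind_ge0|rewrite lee_fin sqr_ge0].
have fin := chord_energy_fin mA mB AN BN N0.
have := @polarization _ _ area (fun w => slope_weight w.1) (chord A) (chord B).
move=> /(_ _ _ mcA (chord_ge0 A) mcB (chord_ge0 B)) hl.
have := @polarization _ _ scaled_area (fun w => pos_ind w.1 * (w.1 ^+ 2)%:E) (square_mass A) (square_mass B).
move=> /(_ _ _ mwA (square_mass_ge0 A) mwB (square_mass_ge0 B)) hs.
have {}hl : _ := hl (ltac:(by meas)) (fun w => pair_kernel_ge0 1 w.1).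
have {}hs : _ := hs (ltac:(by meas)) (fun w => w0 w.1).
move: hl; rewrite !(chord_square_energy mA mA AN AN N0) !(chord_square_energy mB mB BN BN N0).
rewrite hs -!(chord_square_energy mA mB AN BN N0) => h.
set c := 2%:E * _ in h.
have cfin : c \is a fin_num.
  have I0 : 0 <= \int[area]_w (slope_weight w.1 * ((chord A w * chord B w)%:E)).
    apply: integral_ge0 => w _; rewrite mule_ge0 ?pair_kernel_ge0// lee_fin.
    by rewrite mulr_ge0 ?chord_ge0.
  by rewrite fin_numM// ge0_fin_numE.
by rewrite -[LHS](addeK _ cfin) -h addeK.
Qed.

End chords.

(** * Continuity of translations in measure *)

Section translation.
Context {R : realType}.
Notation mu := (@lebesgue_measure R).
Notation area := (sf_prod mu mu).
Local Open Scope ereal_scope.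

Lemma integral_translate (v : R * R) (F : R * R -> \bar R) :
  measurable_fun setT F -> (forall X, 0 <= F X) ->
  \int[area]_X F X = \int[area]_X F (X + v)%R.
Proof.
move=> mF F0.
have mT : measurable_fun setT (fun X : R * R => F (X.1 + v.1, X.2 + v.2)%R) by meas.
rewrite integral_product_iter; [|exact: mF|exact: F0].
have -> : \int[area]_X F (X + v)%R = \int[mu]_x \int[mu]_y F (x + v.1, y + v.2)%R.
  rewrite integral_product_iter; [|exact: mT|by move=> X; exact: F0].
  by [].
rewrite [LHS](@ge0_integral_affine _ 1 v.1); last 3 first.
- exact: oner_neq0.
- by apply: measurable_integral => [|x y]; [meas|exact: F0].
- by move=> x; apply: integral_ge0 => y _; exact: F0.
rewrite normr1 mul1e; apply: eq_integral => x _.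
rewrite [LHS](@ge0_integral_affine _ 1 v.2); last 3 first.
- exact: oner_neq0.
- by meas.
- by move=> y; exact: F0.
by rewrite normr1 mul1e mul1r; apply: eq_integral => y _; rewrite mul1r.
Qed.

Definition shift (v : R * R) (A : set (R * R)) : set (R * R) := [set X | A (X + v)%R].

Lemma measurable_shift v A : measurable A -> measurable (shift v A).
Proof.
move=> mA; rewrite -[X in measurable X]setTI.
have mf : measurable_fun setT (fun X : R * R => (X.1 + v.1, X.2 + v.2)%R) by meas.
exact: mf.
Qed.

Lemma measure_shift v A : measurable A -> area (shift v A) = area A.
Proof.
move=> mA; rewrite -(integral_indicT area mA) (integral_translate v).
- rewrite -(integral_indicT area (measurable_shift v mA)).
  by apply: eq_integral => X _; rewrite !indicE.
- by apply/measurable_EFinP; exact: measurable_indic.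
- by move=> X; rewrite lee_fin.
Qed.

(** Confined to bounded squares, so that the property passes to complements. *)
Definition shift_continuous (A : set (R * R)) := measurable A /\
  forall N e : R, (0 < N)%R -> (0 < e)%R -> exists d : R, (0 < d <= 1)%R /\
  forall v : R * R, (`|v.1| <= d)%R -> (`|v.2| <= d)%R ->
    area (big_square N `&` (A `+` shift v A)) <= e%:E.

Lemma measurable_shiftY v A N : measurable A ->
  measurable (big_square N `&` (A `+` shift v A)).
Proof.
move=> mA; have mS := measurable_shift v mA.
apply: measurableI; first exact: measurable_big_square.
by apply: measurableU; apply: measurableD.
Qed.

Lemma shift_continuousC A : shift_continuous A -> shift_continuous (~` A).
Proof.
move=> [mA cA]; split; first exact: measurableC.
move=> N e N0 e0; have [d [d0 dA]] := cA N e N0 e0.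
exists d; split=> // v v1 v2.
rewrite (_ : ~` A `+` shift v (~` A) = A `+` shift v A); first exact: dA.
by apply/seteqP; split => X [|] [/= h1 h2];
  [right|left|right|left]; split => //=; apply: contrapT.
Qed.

Lemma shift_continuousU A B :
  shift_continuous A -> shift_continuous B -> shift_continuous (A `|` B).
Proof.
move=> [mA cA] [mB cB]; split; first exact: measurableU.
move=> N e N0 e0; have e2 : (0 < e / 2)%R by rewrite divr_gt0.
have [d [/andP[d0 d1] dA]] := cA N _ N0 e2.
have [d' [/andP[d'0 d'1] dB]] := cB N _ N0 e2.
exists (Num.min d d'); split=> [|v].
  by rewrite lt_min d0 d'0 ge_min d1.
rewrite !le_min => /andP[v1 v1'] /andP[v2 v2'].
have := dA v v1 v2; have := dB v v1' v2' => hB hA.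
have mSA := measurable_shiftY v N mA; have mSB := measurable_shiftY v N mB.
have mSU := measurable_shiftY v N (measurableU _ _ mA mB).
rewrite [e]splitr EFinD; apply: le_trans (leeD hA hB).
apply: le_trans (measureU2 area mSA mSB).
apply: le_measure; rewrite ?inE//; first exact: measurableU.
move=> X [NX [[[AX|BX] nX]|[[AX|BX] nX]]].
- by left; split=> //; left; split=> // ?; apply: nX; left.
- by right; split=> //; left; split=> // ?; apply: nX; right.
- by left; split=> //; right; split=> // ?; apply: nX; left.
- by right; split=> //; right; split=> // ?; apply: nX; right.
Qed.

Lemma shift_continuous0 : shift_continuous set0.
Proof.
split=> // N e N0 e0; exists 1%R; split; first by rewrite ltr01 lexx.
move=> v _ _; rewrite (_ : _ `&` _ = set0) ?measure0 ?lee_fin ?ltW//.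
by rewrite -subset0 => X [_ [[]|[]]].
Qed.

(** Some finite union exhausts the whole one up to a set T whose area in the
    square of half-side N + 1 is small. A translation by |v| <= 1 moves a point of the
    square of half-side N within the larger square, so the translate of T costs no
    more than T itself. *)
Lemma shift_continuous_bigcup (F : (set (R * R))^nat) :
  (forall n, shift_continuous (F n)) -> shift_continuous (\bigcup_n F n).
Proof.
move=> cF; have mF n : measurable (F n) by have [] := cF n.
have mG : measurable (\bigcup_n F n) by exact: bigcupT_measurable.
split=> // N e N0 e0.
have cH k : shift_continuous (\big[setU/set0]_(n < k) F n).
  elim: k => [|k IH]; first by rewrite big_ord0; exact: shift_continuous0.
  by rewrite big_ord_recr/=; apply: shift_continuousU.
pose H k := \big[setU/set0]_(n < k) F n.
pose T k := big_square (N + 1) `&` (\bigcup_n F n `\` H k).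
have mH k : measurable (H k) by have [] := cH k.
have mT k : measurable (T k).
  apply: measurableI; first exact: measurable_big_square.
  exact: measurableD.
have e4 : (0 < e / 4)%R by rewrite divr_gt0.
(* Continuity from above, within a square of finite area. *)
have [k Tk] : exists k, area (T k) <= (e / 4)%:E.
  have T0 : \bigcap_k T k = set0.
    rewrite -subset0 => X TX; have [_ [[n _ FX] _]] := TX 0%N I.
    have [_ [_ nH]] := TX n.+1 I; apply: nH.
    by rewrite /H -bigcup_mkord; exists n => //=.
  have cvT : area \o T @ \oo --> area (\bigcap_n T n).
    apply: nonincreasing_cvg_mu => //.
    - apply: le_lt_trans (ltry ((2 * (N + 1)) ^+ 2)).
      have b0 : (0 <= N + 1)%R by rewrite addr_ge0// ltW.
      rewrite -(area_big_square b0); apply: le_measure; rewrite ?inE.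
      + exact: mT.
      + exact: measurable_big_square.
      + by move=> X [].
    - by rewrite T0.
    - move=> n m nm; apply/subsetPset => X [? [? nH]]; do 2!split=> //.
      apply: contra_not nH; rewrite /H -!bigcup_mkord => -[i /= im Fi].
      by exists i => //=; exact: leq_trans nm.
  rewrite T0 measure0 in cvT.
  have : \forall k \near \oo, area (T k) < (e / 4)%:E.
    apply: (cvT [set x | x < (e / 4)%:E]).
    by apply: open_ereal_lt' => //; rewrite lte_fin.
  by move=> [k _ hk]; exists k; apply: ltW; apply: hk => /=.
have [_ cHk] := cH k; have [d [d01 dH]] := cHk N (e / 2)%R N0 (divr_gt0 e0 (ltr0Sn _ _)).
exists d; split=> // v v1 v2; have /andP[d0 d1] := d01.
have hH := dH v v1 v2.
have mS := measurable_shift v (mT k).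
have mY := measurable_shiftY v N (mH k).
have TS : area (shift v (T k)) <= (e / 4)%:E by rewrite measure_shift.
have -> : e%:E = (e / 2)%:E + ((e / 4)%:E + (e / 4)%:E).
  by rewrite -!EFinD; congr EFin; field.
apply: le_trans (leeD hH (leeD Tk TS)).
apply: le_trans (leeD (lexx _) (measureU2 area (mT k) mS)).
apply: le_trans (measureU2 area mY (measurableU _ _ (mT k) mS)).
apply: le_measure; rewrite ?inE//.
- exact: measurable_shiftY.
- exact: (measurableU _ _ mY (measurableU _ _ (mT k) mS)).
have subH X : H k X -> (\bigcup_n F n) X.
  by rewrite /H -bigcup_mkord => -[i _ Fi]; exists i.
move=> X [[NX1 NX2] [[GX nX]|[GX nX]]].
- have [HX|nHX] := pselect (H k X).
    by left; split=> //; left; split=> // /subH.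
  right; left; split=> //; split; lra.
- have [HX|nHX] := pselect (H k (X + v)%R).
    by left; split=> //; right; split=> // /subH.
  right; right; split=> //; split.
    by rewrite (le_trans (ler_normD _ _))//; lra.
  by rewrite (le_trans (ler_normD _ _))//; lra.
Qed.

Lemma shift_continuous_sigma_algebra : sigma_algebra setT shift_continuous.
Proof.
split; [exact: shift_continuous0| |exact: shift_continuous_bigcup].
by move=> A cA; rewrite setTD; exact: shift_continuousC.
Qed.

(** A translation by at most d moves a point in or out of an interval only near
    the end points. *)
Lemma half_open_interval_moved (a b x u d : R) : (`|u| <= d)%R ->
  (`]a, b]%classic `+` [set x | `]a, b]%classic (x + u)%R]) x ->
  (`[(a - d)%R, (a + d)%R]%classic `|` `[(b - d)%R, (b + d)%R]%classic) x.
Proof.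
rewrite ler_norml => /andP[u1 u2].
have [xa|xa] := leP x (a + d)%R; have [xa'|xa'] := leP (a - d)%R x.
- by left; rewrite /= in_itv/= xa xa'.
- move=> [[/= + _]|[/= + _]]; rewrite in_itv/= => /andP[? ?]; exfalso; lra.
- have [xb|xb] := leP x (b + d)%R; have [xb'|xb'] := leP (b - d)%R x.
  + by right; rewrite /= in_itv/= xb xb'.
  + move=> [[/= + +]|[/= + +]]; rewrite !in_itv/= => /andP[? ?] /negP; rewrite negb_and -!ltNge -!leNgt => /orP[?|?]; exfalso; lra.
  + move=> [[/= + _]|[/= + _]]; rewrite in_itv/= => /andP[? ?]; exfalso; lra.
  + exfalso; lra.
- exfalso; lra.
Qed.

Lemma mu_interval_center (a d : R) : (0 <= d)%R ->
  mu `[(a - d)%R, (a + d)%R] = (2 * d)%:E.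
Proof. by move=> d0; rewrite mu_interval; congr EFin; rewrite max_l; lra. Qed.

Lemma mu_two_intervals_le (a b d : R) : (0 <= d)%R ->
  mu (`[(a - d)%R, (a + d)%R] `|` `[(b - d)%R, (b + d)%R]) <= (4 * d)%:E.
Proof.
move=> d0; have -> : (4 * d)%:E = (2 * d)%:E + (2 * d)%:E by rewrite -EFinD; congr EFin; ring.
rewrite -{1}(mu_interval_center a d0) -(mu_interval_center b d0).
by apply: measureU2; exact: measurable_itv.
Qed.

Lemma slab_width (N e : R) : (0 < N)%R -> (0 < e)%R ->
  exists d : R, (0 < d <= 1)%R /\ (4 * d * (2 * N) <= e)%R.
Proof.
move=> N0 e0; exists (Num.min 1 (e / (8 * N)))%R.
have eN : (0 < e / (8 * N))%R by rewrite divr_gt0// mulr_gt0.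
split; first by rewrite lt_min ltr01 eN ge_min lexx.
have : (Num.min 1 (e / (8 * N)) <= e / (8 * N))%R by rewrite ge_min lexx orbT.
rewrite ler_pdivlMr ?mulr_gt0//.
by set m := Num.min _ _; nra.
Qed.

Lemma shift_continuous_fst (a b : R) : shift_continuous (fst @^-1` `]a, b]%classic).
Proof.
split; first by rewrite -[X in measurable X]setTI; apply: measurable_fst.
move=> N e N0 e0; have [d [/andP[d0 d1] dN]] := slab_width N0 e0.
exists d; split; first by rewrite d0.
move=> v v1 v2; pose I := `[(a - d)%R, (a + d)%R]%classic `|` `[(b - d)%R, (b + d)%R]%classic.
have mI : measurable I by apply: measurableU; exact: measurable_itv.
have mJ : measurable `[(- N)%R, N]%classic by exact: measurable_itv.
have : area (I `*` `[(- N)%R, N]%classic) <= e%:E.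
  rewrite sf_prodE//; apply: (@le_trans _ _ ((4 * d)%:E * (2 * N)%:E)).
    have -> : (2 * N)%:E = mu `[(- N)%R, N] by rewrite mu_interval max_l; [congr EFin; ring|lra].
    by apply: lee_wpmul2r => //; apply: mu_two_intervals_le; exact: ltW.
  by rewrite -EFinM lee_fin.
apply: le_trans; apply: le_measure; rewrite ?inE.
- by apply: measurable_shiftY; rewrite -[X in measurable X]setTI; apply: measurable_fst.
- exact: measurableX.
move=> -[x y] [[/= _ yN] xy]; split => /=; last by rewrite in_itv/= -ler_norml.
exact: (@half_open_interval_moved a b x v.1 d).
Qed.

Lemma shift_continuous_snd (a b : R) : shift_continuous (snd @^-1` `]a, b]%classic).
Proof.
split; first by rewrite -[X in measurable X]setTI; apply: measurable_snd.
move=> N e N0 e0; have [d [/andP[d0 d1] dN]] := slab_width N0 e0.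
exists d; split; first by rewrite d0.
move=> v v1 v2; pose I := `[(a - d)%R, (a + d)%R]%classic `|` `[(b - d)%R, (b + d)%R]%classic.
have mI : measurable I by apply: measurableU; exact: measurable_itv.
have mJ : measurable `[(- N)%R, N]%classic by exact: measurable_itv.
have : area (`[(- N)%R, N]%classic `*` I) <= e%:E.
  rewrite sf_prodE//; apply: (@le_trans _ _ ((2 * N)%:E * (4 * d)%:E)).
    have -> : (2 * N)%:E = mu `[(- N)%R, N] by rewrite mu_interval max_l; [congr EFin; ring|lra].
    by apply: lee_wpmul2l => //; apply: mu_two_intervals_le; exact: ltW.
  by rewrite -EFinM lee_fin mulrC.
apply: le_trans; apply: le_measure; rewrite ?inE.
- by apply: measurable_shiftY; rewrite -[X in measurable X]setTI; apply: measurable_snd.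
- exact: measurableX.
move=> -[x y] [[/= xN _] xy]; split => /=; first by rewrite in_itv/= -ler_norml.
exact: (@half_open_interval_moved a b y v.2 d).
Qed.

Lemma preimage_sigma_algebra T U (f : T -> U) (D : set (set T)) :
  sigma_algebra setT D -> sigma_algebra setT [set B | D (f @^-1` B)].
Proof.
move=> [D0 DC DU]; split => /=.
- by rewrite preimage_set0.
- by move=> B /DC; rewrite !setTD preimage_setC.
- by move=> F DF; rewrite preimage_bigcup; exact: DU.
Qed.

(** The sets with this property form a sigma-algebra, and slabs over half-open
    intervals belong to it. *)
Theorem translation_continuity (A : set (R * R)) : measurable A -> shift_continuous A.
Proof.
have SA := shift_continuous_sigma_algebra.
apply: smallest_sub => //.
have sub f : (forall a b : R, shift_continuous (f @^-1` `]a, b]%classic)) ->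
    preimage_set_system setT f (@measurable _ R) `<=` shift_continuous.
  move=> ab _ [B mB <-]; rewrite setTI.
  have : <<s @ocitv R >> `<=` [set B | shift_continuous (f @^-1` B)].
    apply: smallest_sub; first exact: preimage_sigma_algebra.
    by move=> _ [[a b] _ <-]; exact: ab.
  by apply.
by rewrite subUset; split; apply: sub; [exact: shift_continuous_fst|exact: shift_continuous_snd].
Qed.

End translation.

(** * Colorings of the translates of a tile *)

Section tiling.
Context {R : realType}.
Notation mu := (@lebesgue_measure R).
Notation area := (sf_prod mu mu).

Lemma zbasis_enum (T : set (R * R)) a b : zbasis T a b ->
  exists e : nat -> R * R, T = range e.
Proof.
move=> [TE _].
exists (fun n => if unpickle n is Some (m, k) then a *~ m + b *~ k else 0 : R * R).
rewrite TE; apply/seteqP; split => t /=.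
  by move=> [m [n ->]]; exists (pickle (m, n)) => //; rewrite pickleK.
move=> [n _ <-]; case: unpickle => [[m k]|]; first by exists m, k.
by exists 0, 0; rewrite !mulr0z addr0.
Qed.

(** A Lebesgue measurable tile is replaced by a Borel subset, at the price of a
    Borel null set. *)
Lemma borel_core (Q : set (R * R)) : lebesgue_measurable2 Q ->
  exists C Z : set (R * R), [/\ measurable C, measurable Z, area Z = 0%E, C `<=` Q & Q `<=` C `|` Z].
Proof.
move=> [C mC [N [Z [mZ Z0 NZ]]] <-]; exists C, Z; split => //.
by move=> x [Cx|/NZ Zx]; [left|right].
Qed.

Variables (T Q C Z : set (R * R)) (z : R * R -> R) (e : nat -> R * R).
Hypotheses (T0 : T 0) (TB : forall s t, T s -> T t -> T (s - t)) (Te : T = range e).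
Hypotheses (fQ : fundamental_domain T Q).
Hypotheses (mC : measurable C) (mZ : measurable Z) (Z0 : area Z = 0%E).
Hypotheses (CQ : C `<=` Q) (QCZ : Q `<=` C `|` Z).
Hypothesis z1 : forall t, T t -> z t = -1 \/ z t = 1.

Definition tiles (c : R) : set (R * R) := [set x | exists t, [/\ T t, z t = c & C (x - t)]].
(** The null set off which the coloring agrees with its Borel version. *)
Definition seams : set (R * R) := [set x | exists2 t, T t & Z (x - t)].

Lemma tile_exists x : exists2 t, T t & Q (x - t).
Proof.
have [q [[Qq Tq] _]] := fQ x; exists (x - q); last by rewrite opprB addrC subrK.
by rewrite -[x - q]opprB -sub0r; exact: TB.
Qed.

Lemma tile_unique x t t' : T t -> T t' -> Q (x - t) -> Q (x - t') -> t = t'.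
Proof.
have [q [_ uq]] := fQ x.
have sub u : T u -> Q (x - u) -> q = x - u.
  move=> Tu Qu; apply: uq; split=> //.
  by rewrite addrAC subrr -[X in T X]/(0 - u); exact: TB.
by move=> Tt Tt' /(sub _ Tt) qt /(sub _ Tt'); rewrite qt => /addrI /oppr_inj.
Qed.

Lemma coloring_tile x t : T t -> Q (x - t) -> coloring T Q z x = z t.
Proof.
move=> Tt Qt; rewrite /coloring -(fsbig_widen [set t] T).
- by rewrite fsbig_set1 indicE mem_set ?mulr1.
- by move=> u ->.
- move=> u [Tu ut] /=; rewrite indicE memNset ?mulr0// => Qu.
  by apply: ut; exact: (tile_unique Tu Tt Qu Qt).
Qed.

Lemma tiles_disjoint : tiles 1 `&` tiles (-1) = set0.
Proof.
rewrite -subset0 => x [[t [Tt zt Ct]] [u [Tu zu Cu]]].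
have tu := tile_unique Tt Tu (CQ Ct) (CQ Cu).
by move: zt; rewrite tu zu => /eqP; rewrite eqr_oppLR -subr_eq0 opprK -(natrD _ 1 1) pnatr_eq0.
Qed.

Lemma seams_or_tile x : seams x \/ exists2 t, T t & C (x - t).
Proof.
have [t Tt /QCZ[Cx|Zx]] := tile_exists x; first by right; exists t.
by left; exists t.
Qed.

Lemma seams_or_tiles x : [\/ seams x, tiles 1 x | tiles (-1) x].
Proof.
have [?|[t Tt Cx]] := seams_or_tile x; first by constructor 1.
by have [zt|zt] := z1 Tt; [constructor 3|constructor 2]; exists t.
Qed.

Lemma coloring_tiles x : ~ seams x ->
  coloring T Q z x = \1_(tiles 1) x - \1_(tiles (-1)) x.
Proof.
move=> nx; have disj : ~ (tiles 1 x /\ tiles (-1) x).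
  by move=> h; have : (tiles 1 `&` tiles (-1)) x by []; rewrite tiles_disjoint.
have [//|px|px] := seams_or_tiles x.
- rewrite !indicE mem_set// memNset ?subr0; last by move=> h; apply: disj.
  by have [t [Tt zt Ct]] := px; rewrite (coloring_tile Tt (CQ Ct)) zt.
- rewrite !indicE [in X in _ - X]mem_set// memNset ?sub0r; last by move=> h; apply: disj.
  by have [t [Tt zt Ct]] := px; rewrite (coloring_tile Tt (CQ Ct)) zt.
Qed.

Lemma measurable_tiles c : measurable (tiles c).
Proof.
rewrite (_ : tiles c = \bigcup_n (if z (e n) == c then shift (- e n) C else set0)).
  by apply: bigcupT_measurable => n; case: ifP => _ //; exact: measurable_shift.
apply/seteqP; split => x.
  move=> [t []]; rewrite Te => -[n _ <-] zt Ct; exists n => //=.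
  by rewrite zt eqxx.
move=> [n _]; case: eqP => // zn Cn; exists (e n); split => //.
by rewrite Te; exists n.
Qed.

Lemma seamsE : seams = \bigcup_n shift (- e n) Z.
Proof.
apply/seteqP; split => x.
  by move=> [t]; rewrite Te => -[n _ <-] Zt; exists n.
by move=> [n _ Zn]; exists (e n) => //; rewrite Te; exists n.
Qed.

Lemma measurable_seams : measurable seams.
Proof. by rewrite seamsE; apply: bigcupT_measurable => n; exact: measurable_shift. Qed.

Lemma seams_null : area seams = 0%E.
Proof.
apply/eqP; rewrite -measure_le0.
have : area.-negligible seams.
  rewrite seamsE; apply: negligible_bigcup => n.
  exists (shift (- e n) Z); split => //; first exact: measurable_shift.
  by rewrite -[RHS]Z0; apply: measure_shift.
move=> [A [mA A0 sA]]; rewrite -A0; apply: le_measure; rewrite ?inE//.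
exact: measurable_seams.
Qed.
End tiling.

Section counting.
Context {R : realType}.

Lemma pair_mulrz (a : R * R) (m : int) : a *~ m = (a.1 * m%:~R, a.2 * m%:~R).
Proof.
have nat_case n : a *+ n = (a.1 *+ n, a.2 *+ n).
  elim: n => [|n IH]; first by rewrite !mulr0n.
  by rewrite !mulrS IH.
case: m => n; first by rewrite -pmulrn nat_case -!pmulrn !mulr_natr.
by rewrite NegzE !mulrNz -!pmulrn nat_case !mulrN !mulr_natr.
Qed.

(** Cramer's rule, for a basis of determinant 1 or -1. *)
Lemma lattice_point_coordinates (a b : R * R) (m n : int) (M : R) :
  parallelogram_area a b = 1 ->
  `|(a *~ m + b *~ n).1| <= M -> `|(a *~ m + b *~ n).2| <= M ->
  `|m%:~R : R| <= M * (`|a.1| + `|a.2| + `|b.1| + `|b.2|) /\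
  `|n%:~R : R| <= M * (`|a.1| + `|a.2| + `|b.1| + `|b.2|).
Proof.
rewrite /parallelogram_area => ab.
have E1 : (a *~ m + b *~ n).1 = a.1 * m%:~R + b.1 * n%:~R by rewrite !pair_mulrz.
have E2 : (a *~ m + b *~ n).2 = a.2 * m%:~R + b.2 * n%:~R by rewrite !pair_mulrz.
rewrite E1 E2; set x := (m%:~R : R); set y := (n%:~R : R) => h1 h2.
have M0 : 0 <= M by apply: le_trans h1.
split.
- have -> : `|x| = `|(a.1 * x + b.1 * y) * b.2 - (a.2 * x + b.2 * y) * b.1|.
    rewrite -[LHS]mul1r -ab -normrM; congr `|_|; ring.
  apply: le_trans (ler_normB _ _) _; rewrite !normrM.
  have := ler_wpM2r (normr_ge0 b.2) h1; have := ler_wpM2r (normr_ge0 b.1) h2.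
  have := mulr_ge0 M0 (normr_ge0 a.1); have := mulr_ge0 M0 (normr_ge0 a.2); lra.
- have -> : `|y| = `|(a.2 * x + b.2 * y) * a.1 - (a.1 * x + b.1 * y) * a.2|.
    rewrite -[LHS]mul1r -ab -normrM; congr `|_|; ring.
  apply: le_trans (ler_normB _ _) _; rewrite !normrM.
  have := ler_wpM2r (normr_ge0 a.2) h1; have := ler_wpM2r (normr_ge0 a.1) h2.
  have := mulr_ge0 M0 (normr_ge0 b.1); have := mulr_ge0 M0 (normr_ge0 b.2); lra.
Qed.
End counting.

(** * Integrals along segments *)

Section lebesgue_line.
Context {R : realType}.
Notation mu := (@lebesgue_measure R).
Notation cmu := (@completed_lebesgue_measure R).
Notation LT := (lebesgueTypeR R).
Local Open Scope ereal_scope.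

Lemma borel_lebesgue (A : set R) : measurable A -> measurable (A : set LT).
Proof. exact: sub_caratheodory. Qed.

Lemma completed_borel (A : set R) : cmu A = mu A.
Proof. by []. Qed.

Lemma null_lebesgue (E A : set R) : measurable E -> mu E = 0 -> A `<=` E -> measurable (A : set LT).
Proof.
move=> mE E0 AE; apply: (@completed_lebesgue_measure_is_complete R).
by exists (E : set LT); split => //; exact: borel_lebesgue.
Qed.

(** Completeness: every subset of a Borel null set is Lebesgue measurable, while
    the restriction to a line of a Lebesgue measurable function on the plane is only
    known up to a null set. *)
Lemma ae_borel_measurable (g h : R -> R) (E : set R) :
  measurable_fun setT g -> measurable E -> mu E = 0 ->
  (forall s, ~ E s -> h s = g s) -> measurable_fun (setT : set LT) (h : LT -> R).
Proof.
move=> mg mE E0 hg _ Y mY; rewrite setTI.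
have -> : h @^-1` Y = (g @^-1` Y `\` E) `|` (h @^-1` Y `&` E).
  apply/seteqP; split => s /=.
    by have [Es|nEs] := pselect (E s); [right|left; split; rewrite //= -?hg].
  by move=> [[gY nE]|[]//]; rewrite hg.
apply: measurableU; last by apply: null_lebesgue mE E0 _; exact: subIsetr.
apply: borel_lebesgue; apply: measurableD => //.
by rewrite -[X in measurable X]setTI; exact: mg.
Qed.

Lemma mu_setI_itv_le (A : set R) (x0 x1 : R) : measurable A ->
  mu (A `&` `[x0, x1]) <= mu `[x0, x1].
Proof.
move=> mA; apply: le_measure; rewrite ?inE.
- by apply: measurableI => //; exact: measurable_itv.
- exact: measurable_itv.
- exact: subIsetr.
Qed.

Lemma mu_setI_itv_fin (A : set R) (x0 x1 : R) : measurable A ->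
  mu (A `&` `[x0, x1]) \is a fin_num.
Proof.
move=> mA; rewrite ge0_fin_numE//; apply: le_lt_trans (mu_setI_itv_le _ _ mA) _.
by rewrite mu_interval ltry.
Qed.

Lemma completed_integral_indicB (A B E : set R) (L : R) (h : R -> R) :
  measurable A -> measurable B -> measurable E -> mu E = 0 ->
  (forall s, ~ E s -> h s = (\1_A s - \1_B s)%R) ->
  \int[cmu]_(s in `[0%R, L]) (h s)%:E =
  (fine (mu (A `&` `[0%R, L])) - fine (mu (B `&` `[0%R, L])))%:E.
Proof.
move=> mA mB mE E0 hE.
have mI : measurable (`[0%R, L]%classic : set LT) by apply: borel_lebesgue; exact: measurable_itv.
have mA' := borel_lebesgue mA; have mB' := borel_lebesgue mB.
have mg : measurable_fun setT (fun s : R => \1_A s - \1_B s : R)%R.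
  by apply: measurable_funB; exact: measurable_indic.
have mh := ae_borel_measurable mg mE E0 hE.
have mfin (C : set R) : measurable C -> mu (C `&` `[0%R, L]) < +oo.
  by move=> mC; rewrite -ge0_fin_numE//; exact: mu_setI_itv_fin.
have iI (C : set R) : measurable C -> cmu.-integrable (`[0%R, L]%classic : set LT) (fun s : LT => (\1_(C : set LT) s)%:E : \bar R).
  move=> mC; have mC' := borel_lebesgue mC; apply/integrableP; split.
    by apply/measurable_EFinP; exact: measurable_indic.
  rewrite (_ : \int[cmu]_(x in _) _ = mu (C `&` `[0%R, L])); first exact: mfin.
  rewrite -completed_borel -(integral_indic cmu mI mC').
  by apply: eq_integral => s _; rewrite gee0_abs// lee_fin.
transitivity (\int[cmu]_(s in (`[0%R, L]%classic : set LT)) ((\1_(A : set LT) s)%:E - (\1_(B : set LT) s)%:E)).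
  apply: ae_eq_integral.
  - exact: mI.
  - by apply/measurable_EFinP; exact: measurable_funTS.
  - by apply: emeasurable_funB; apply/measurable_EFinP; exact: measurable_indic.
  - exists (E : set LT); split; [exact: borel_lebesgue|exact: E0|].
    move=> s /= /not_implyP[_]; apply: contra_notP => nE.
    by rewrite hE// EFinB.
transitivity (\int[cmu]_(s in (`[0%R, L]%classic : set LT)) (\1_(A : set LT) s)%:E -
  \int[cmu]_(s in (`[0%R, L]%classic : set LT)) (\1_(B : set LT) s)%:E).
  exact: (integralB mI (iI A mA) (iI B mB)).
rewrite (integral_indic cmu mI mA') (integral_indic cmu mI mB').
rewrite EFinB !fineK ?ge0_fin_numE//; exact: mfin.
Qed.

Lemma mu_preimage_affine (q p : R) (A : set R) : (0 < q)%R -> measurable A ->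
  mu [set s | A (p + s / q)%R] = q%:E * mu A.
Proof.
move=> q0 mA.
have mA' : measurable [set s | A (p + s / q)%R].
  rewrite -[X in measurable X]setTI.
  have mf : measurable_fun setT (fun s : R => p + s * q^-1)%R by meas.
  exact: mf.
rewrite -(integral_indicT mu mA) -(integral_indicT mu mA').
rewrite [in RHS](@ge0_integral_affine _ q^-1 p); last 3 first.
- by rewrite invr_eq0 gt_eqF.
- by apply/measurable_EFinP; exact: measurable_indic.
- by move=> x; rewrite lee_fin.
rewrite muleA gtr0_norm ?invr_gt0// -EFinM divff ?gt_eqF// mul1e.
apply: eq_integral => s _; have -> : (q^-1 * s + p = p + s / q)%R by ring.
by rewrite !indicE.
Qed.

End lebesgue_line.

Section segments.
Context {R : realType}.
Notation mu := (@lebesgue_measure R).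

Definition graph_point (m c x : R) : R * R := (x, m * x + c).

Definition slope_norm (m : R) : R := Num.sqrt (1 + m ^+ 2).

Lemma slope_norm_gt0 m : 0 < slope_norm m.
Proof. by rewrite sqrtr_gt0; apply: ltr_pwDl => //; exact: sqr_ge0. Qed.

Lemma slope_norm_sqr m : slope_norm m ^+ 2 = 1 + m ^+ 2.
Proof. by rewrite sqr_sqrtr//; apply: addr_ge0 => //; exact: sqr_ge0. Qed.

Lemma graph_seg_length m c x0 x1 : x0 < x1 ->
  seg_length (graph_point m c x0) (graph_point m c x1) = (x1 - x0) * slope_norm m.
Proof.
move=> x01; rewrite /seg_length /enorm /=.
have -> : (x1 - x0) ^+ 2 + (m * x1 + c - (m * x0 + c)) ^+ 2 = (x1 - x0) ^+ 2 * (1 + m ^+ 2).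
  by ring.
by rewrite sqrtrM ?sqr_ge0// sqrtr_sqr ger0_norm// subr_ge0 ltW.
Qed.

Lemma graph_line_param m c x0 x1 s : x0 < x1 ->
  line_param (graph_point m c x0) (graph_point m c x1) s =
  graph_point m c (x0 + s / slope_norm m).
Proof.
move=> x01; have s0 := slope_norm_gt0 m.
rewrite /line_param (graph_seg_length _ _ x01).
rewrite -[LHS]/(x0 + s / ((x1 - x0) * slope_norm m) * (x1 - x0),
  m * x0 + c + s / ((x1 - x0) * slope_norm m) * (m * x1 + c - (m * x0 + c))).
have x10 : x1 - x0 != 0 by rewrite subr_eq0 gt_eqF.
by congr pair; field; rewrite x10 gt_eqF.
Qed.

Section chord_integral.
Variables (f : R * R -> R) (P M S : set (R * R)).
Hypotheses (mP : measurable P) (mM : measurable M) (mS : measurable S).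
Hypothesis fPM : forall x, ~ S x -> f x = \1_P x - \1_M x.

(** The unit speed parametrization runs through the abscissas x0 + s / q with
    q = sqrt (1 + m ^ 2), so arclength is q times Lebesgue measure of abscissas, and
    null sets of abscissas pull back to null sets. *)
Lemma graph_seg_integral m c x0 x1 : x0 < x1 ->
  mu [set x | S (x, m * x + c)] = 0%E ->
  measurable_on_line f (graph_point m c x0) (graph_point m c x1) /\
  seg_integral f (graph_point m c x0) (graph_point m c x1) =
  slope_norm m * (fine (mu ([set x | P (x, m * x + c)] `&` `[x0, x1]))
    - fine (mu ([set x | M (x, m * x + c)] `&` `[x0, x1]))).
Proof.
move=> x01 S0; set q := slope_norm m; have q0 : 0 < q := slope_norm_gt0 m.
pose pull (A : set (R * R)) := [set s | A (graph_point m c (x0 + s / q))].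
have mpull (A : set (R * R)) : measurable A -> measurable (pull A).
  move=> mA; rewrite -[X in measurable X]setTI.
  have mf : measurable_fun setT (fun s : R => (x0 + s * q^-1, m * (x0 + s * q^-1) + c)).
    by meas.
  exact: mf.
have pullS0 : mu (pull S) = 0%E.
  rewrite -[LHS]/(mu [set s | [set x | S (x, m * x + c)] (x0 + s / q)]).
  by rewrite mu_preimage_affine// ?S0 ?mule0//; exact: measurable_line.
have fE s : ~ pull S s -> f (line_param (graph_point m c x0) (graph_point m c x1) s) =
    \1_(pull P) s - \1_(pull M) s.
  by move=> nS; rewrite graph_line_param// fPM// !indicE.
split.
  apply: (@ae_borel_measurable _ (fun s => \1_(pull P) s - \1_(pull M) s) _ (pull S)) => //.
  - by apply: measurable_funB; apply: measurable_indic; exact: mpull.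
  - exact: mpull.
rewrite /seg_integral /Rintegral.
rewrite (@completed_integral_indicB _ (pull P) (pull M) (pull S))//=; try exact: mpull.
have scale (A : set (R * R)) : measurable A ->
    fine (mu (pull A `&` `[0, seg_length (graph_point m c x0) (graph_point m c x1)])) =
    q * fine (mu ([set x | A (x, m * x + c)] `&` `[x0, x1])).
  move=> mA; have -> : pull A `&` `[0, seg_length (graph_point m c x0) (graph_point m c x1)] =
      [set s | ([set x | A (x, m * x + c)] `&` `[x0, x1]) (x0 + s / q)].
    rewrite graph_seg_length// -/q; apply/seteqP; split => s [As].
      move=> /=; rewrite !in_itv/= => /andP[s0 s1]; split => //=.
      by rewrite lerDl divr_ge0 ?(ltW q0)//= -lerBrDl ler_pdivrMr.
    move=> /=; rewrite !in_itv/= => /andP[s0 s1]; split => //=.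
    move: s0; rewrite lerDl pmulr_lge0 ?invr_gt0// => ->/=.
    by move: s1; rewrite -lerBrDl ler_pdivrMr.
  have mA' : measurable ([set x | A (x, m * x + c)] `&` `[x0, x1]).
    by apply: measurableI; [exact: measurable_line|exact: measurable_itv].
  rewrite mu_preimage_affine//.
  by rewrite fineM//; apply: mu_setI_itv_fin; exact: measurable_line.
by rewrite !scale// mulrBr.
Qed.

Lemma big_square_chord (N m c : R) : exists x0 x1 : R,
  [set x | big_square N (x, m * x + c)] = `[x0, x1]%classic.
Proof.
have [->|m0] := eqVneq m 0.
  have [cN|cN] := lerP `|c| N.
    exists (- N), N; apply/seteqP; split => x; rewrite /big_square/= mul0r add0r in_itv/= -ler_norml.
      by case.
    by move=> ->.
  exists 1, 0; rewrite set_itv_ge; last by rewrite bnd_simp -ltNge ltr01.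
  by rewrite -subset0 => x [/= _]; rewrite mul0r add0r leNgt cN.
have mm0 : 0 < `|m| by rewrite normr_gt0.
exists (Num.max (- N) (- c / m - N / `|m|)), (Num.min N (- c / m + N / `|m|)).
have yE x : (`|m * x + c| <= N) = (- c / m - N / `|m| <= x <= - c / m + N / `|m|).
  rewrite -ler_distl (_ : m * x + c = m * (x - - c / m)); last by field.
  by rewrite normrM [N / _]mulrC ler_pdivlMl.
apply/seteqP; split => x; rewrite /big_square/= in_itv/= ge_max le_min yE ler_norml.
  by move=> [/andP[-> ->] /andP[-> ->]].
by move=> /andP[/andP[-> ->] /andP[-> ->]].
Qed.

(** A chord of the big square is a segment of length at most 4 N. If it is longer
    than l, the bound assumed on segments applies; otherwise its integral is at most
    its length. The factor 1 + w.1 ^ 2 converts abscissas into arclength. *)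
Lemma chord_discrepancy_le (N l K : R) w : 0 < N -> 0 <= K ->
  (forall a b, l <= seg_length a b -> measurable_on_line f a b ->
     `|seg_integral f a b| < K * Num.sqrt (seg_length a b)) ->
  mu [set x | S (x, w.1 * x + w.2)] = 0%E ->
  (1 + w.1 ^+ 2) * (chord (P `&` big_square N) w - chord (M `&` big_square N) w) ^+ 2
    <= l ^+ 2 + 4 * K ^+ 2 * N.
Proof.
move=> N0 K0 small S0.
have [x0 [x1 sqE]] := big_square_chord N w.1 w.2.
have cE (A : set (R * R)) : chord (A `&` big_square N) w =
    fine (mu ([set x | A (x, w.1 * x + w.2)] `&` `[x0, x1])).
  by rewrite /chord -sqE.
have R0 : 0 <= l ^+ 2 + 4 * K ^+ 2 * N.
  by rewrite addr_ge0 ?sqr_ge0// !mulr_ge0 ?sqr_ge0// ltW.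
have [x01|x10] := ltP x0 x1; last first.
  have c0 (A : set (R * R)) : measurable A -> chord (A `&` big_square N) w = 0.
    move=> mA; rewrite cE; apply: (congr1 fine (y := 0%E)); apply/eqP; rewrite -measure_le0.
    apply: le_trans (mu_setI_itv_le _ _ _) _; first exact: measurable_line.
    by rewrite mu_interval max_r// subr_le0.
  by rewrite !c0// subrr expr0n/= mulr0.
have [mf intf] := graph_seg_integral x01 S0.
set a0 := graph_point _ _ _ in mf intf; set b0 := graph_point _ _ _ in mf intf.
set D := _ - _.
have DE : slope_norm w.1 * D = seg_integral f a0 b0 by rewrite intf /D !cE.
rewrite -slope_norm_sqr -exprMn DE -real_normK ?num_real//.
have len0 : 0 <= seg_length a0 b0 by exact: sqrtr_ge0.
have lenE : seg_length a0 b0 = (x1 - x0) * slope_norm w.1 by exact: graph_seg_length.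
have s0 := slope_norm_gt0 w.1.
have [long|short] := leP l (seg_length a0 b0).
  have len4 : seg_length a0 b0 <= 4 * N.
    have [x0N y0N] : big_square N (x0, w.1 * x0 + w.2).
      by rewrite -[big_square _ _]/([set x | big_square N (x, w.1 * x + w.2)] x0) sqE /= in_itv/= lexx ltW.
    have [x1N y1N] : big_square N (x1, w.1 * x1 + w.2).
      by rewrite -[big_square _ _]/([set x | big_square N (x, w.1 * x + w.2)] x1) sqE /= in_itv/= lexx ltW.
    move: x0N y0N x1N y1N => /=; rewrite !ler_norml => /andP[? ?] /andP[? ?] /andP[? ?] /andP[? ?].
    rewrite -(ler_pXn2r (n := 2)) ?nnegrE//; last by lra.
    rewrite lenE exprMn slope_norm_sqr.
    have : (x1 - x0) ^+ 2 <= (2 * N) ^+ 2 by rewrite lerXn2r ?nnegrE//; lra.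
    have : (w.1 * (x1 - x0)) ^+ 2 <= (2 * N) ^+ 2.
      by rewrite -real_normK ?num_real// lerXn2r ?nnegrE//; [lra|rewrite ler_norml; apply/andP; split; lra].
    by rewrite !exprMn; have := sqr_ge0 N; lra.
  have := small _ _ long mf; move/ltW => h.
  have h2 : `|seg_integral f a0 b0| ^+ 2 <= (K * Num.sqrt (seg_length a0 b0)) ^+ 2.
    by rewrite lerXn2r ?nnegrE// mulr_ge0// sqrtr_ge0.
  apply: le_trans h2 _; rewrite exprMn sqr_sqrtr//.
  have := ler_wpM2l (sqr_ge0 K) len4; have := sqr_ge0 l; lra.
have chord_bnd (A : set (R * R)) : measurable A -> 0 <= chord (A `&` big_square N) w <= x1 - x0.
  move=> mA; rewrite chord_ge0 /= cE.
  have -> : x1 - x0 = fine (mu `[x0, x1]) by rewrite mu_interval/= max_l// subr_ge0 ltW.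
  apply: fine_le.
  - by apply: mu_setI_itv_fin; exact: measurable_line.
  - by rewrite mu_interval.
  - by apply: mu_setI_itv_le; exact: measurable_line.
have /andP[p0 p1] := chord_bnd _ mP; have /andP[m0 m1] := chord_bnd _ mM.
have D1 : `|D| <= x1 - x0 by rewrite /D ler_norml; apply/andP; split; lra.
have : `|seg_integral f a0 b0| <= l.
  rewrite -DE normrM (gtr0_norm s0); apply: le_trans (ltW short).
  by rewrite lenE mulrC ler_wpM2r// ltW.
move=> h; have : `|seg_integral f a0 b0| ^+ 2 <= l ^+ 2.
  by rewrite lerXn2r ?nnegrE//; exact: le_trans h.
have : 0 <= 4 * K ^+ 2 * N by rewrite !mulr_ge0 ?sqr_ge0// ltW.
by lra.
Qed.
End chord_integral.
End segments.

(** * Upper bound for the line energy *)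

Section upper.
Context {R : realType}.
Notation mu := (@lebesgue_measure R).
Notation area := (sf_prod mu mu).
Local Open Scope ereal_scope.

(** The parallel lines of a given slope sweep the plane, so by Tonelli's theorem
    the integral over c of the lengths cut out of S is the area of S. *)
Lemma null_lines (S : set (R * R)) : measurable S -> area S = 0 ->
  {ae area, forall w : R * R, mu [set x | S (x, w.1 * x + w.2)%R] = 0}.
Proof.
move=> mS S0.
have mi : measurable_fun setT (\1_S : R * R -> R) by exact: measurable_indic.
pose F (w : R * R) := \int[mu]_x (\1_S (x, w.1 * x + w.2)%R)%:E.
have FE w : F w = mu [set x | S (x, w.1 * x + w.2)%R].
  rewrite -(integral_indicT mu (measurable_line w.1 w.2 mS)).
  by apply: eq_integral => x _; rewrite !indicE.
have mG : measurable_fun setT (fun z : (R * R) * R => (\1_S (z.2, z.1.1 * z.2 + z.1.2)%R)%:E : \bar R).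
  by apply/measurable_EFinP; apply: (measurableT_comp mi); meas.
have mF : measurable_fun setT F.
  by apply: measurable_integral => [|w x]; [exact: mG|rewrite lee_fin].
have F0 w : 0 <= F w by rewrite FE.
have intF : \int[area]_w F w = 0.
  rewrite integral_product_iter; [|exact: mF|exact: F0].
  rewrite integral0_eq// => m _.
  rewrite (@tonelli_line _ (fun c x => (\1_S (x, m * x + c)%R)%:E)); last 2 first.
  - by apply/measurable_EFinP; apply: (measurableT_comp mi); meas.
  - by move=> c x; rewrite lee_fin.
  rewrite -S0 -(integral_indicT area mS) integral_product_iter; last 2 first.
  - by apply/measurable_EFinP.
  - by move=> x; rewrite lee_fin.
  apply: eq_integral => x _.
  rewrite [RHS](@ge0_integral_affine _ 1 (m * x)); last 3 first.
  - exact: oner_neq0.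
  - by apply/measurable_EFinP; apply: (measurableT_comp mi); meas.
  - by move=> y; rewrite lee_fin.
  by rewrite normr1 mul1e; apply: eq_integral => c _; rewrite mul1r addrC.
have : ae_eq area setT F (cst 0).
  apply/ae_eq_integral_abs => //.
  by rewrite -[RHS]intF; apply: eq_integral => w _; rewrite gee0_abs.
by apply: filterS => w /(_ I) /= <-; rewrite FE.
Qed.

(** [chord_discrepancy_le] holds on almost every line, and the lines that meet the
    big square have finite weighted mass by [line_mass_le]. *)
Lemma line_energy_le (f : R * R -> R) (P M S : set (R * R)) (N l K : R) :
  measurable P -> measurable M -> measurable S -> area S = 0 ->
  (forall x, ~ S x -> f x = \1_P x - \1_M x)%R ->
  (0 < N)%R -> (0 <= K)%R ->
  (forall a b, l <= seg_length a b -> measurable_on_line f a b ->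
     `|seg_integral f a b| < K * Num.sqrt (seg_length a b))%R ->
  \int[area]_w (slope_weight w.1 *
    ((chord (P `&` big_square N) w - chord (M `&` big_square N) w) ^+ 2)%:E) <=
  (4 * N * (l ^+ 2 + 4 * K ^+ 2 * N) * pi)%:E.
Proof.
move=> mP mM mS S0 fPM N0 K0 small.
have mb := @measurable_big_square R N.
have mPN : measurable (P `&` big_square N) by exact: measurableI.
have mMN : measurable (M `&` big_square N) by exact: measurableI.
have D0 : (0 <= l ^+ 2 + 4 * K ^+ 2 * N)%R.
  by rewrite addr_ge0 ?sqr_ge0// !mulr_ge0 ?sqr_ge0// ltW.
apply: le_trans (line_mass_le N0 D0).
have mr := @measurable_slope_weight R.
have mcP := measurable_chord mPN; have mcM := measurable_chord mMN.
apply: ae_ge0_le_integral.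
- exact: measurableT.
- by move=> w _; rewrite mule_ge0 ?pair_kernel_ge0// lee_fin sqr_ge0.
- by meas.
- move=> w _; rewrite mule_ge0 ?pair_kernel_ge0// lee_fin mulr_ge0// divr_ge0//.
  by apply: addr_ge0 => //; exact: sqr_ge0.
- exact: measurable_line_mass.
have [B [mB B0 hB]] := null_lines mS S0; exists B; split => //.
apply: subset_trans hB => w /= /not_implyP[_]; apply: contra_not => Sw.
apply: lee_wpmul2l; first exact: pair_kernel_ge0.
rewrite lee_fin; have [wN|wN] := lerP `|w.2|%R (N * (1 + `|w.1|))%R; last first.
  rewrite !(chord_eq0 _ N0 wN) ?subrr ?expr0n/= ?mul0r//; by move=> x [].
rewrite mul1r ler_pdivlMr; last by apply: ltr_pwDl => //; exact: sqr_ge0.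
by rewrite mulrC; exact: (chord_discrepancy_le mP mM mS fPM N0 K0 small Sw).
Qed.
End upper.

(** * Lower bound for the square energy *)

Section deficiency.
Context {R : realType}.
Notation mu := (@lebesgue_measure R).
Notation area := (sf_prod mu mu).
Notation scaled_area := (sf_prod mu area).
Local Open Scope ereal_scope.

Lemma area_corner_square (s : R) P : (0 < s)%R -> area (corner_square s P) = (s ^- 2)%:E.
Proof.
move=> s0.
have -> : corner_square s P = `[P.1, (P.1 + s^-1)%R[%classic `*` `[P.2, (P.2 + s^-1)%R[%classic.
  apply/seteqP; split => -[x y]; rewrite /corner_square/= !in_itv/=.
    move=> /andP[/andP[x0 x1] /andP[y0 y1]].
    move: x0 y0; rewrite !pmulr_rge0// !subr_ge0 => -> ->/=.
    by move: x1 y1; rewrite -!ltr_pdivlMl// !mulr1 !ltrBlDl => -> ->.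
  move=> [/andP[x0 x1] /andP[y0 y1]].
  rewrite !pmulr_rge0// !subr_ge0 x0 y0/=.
  by rewrite -!ltr_pdivlMl// !mulr1 !ltrBlDl x1 y1.
rewrite sf_prodE//= !lebesgue_measure_itv/= !lte_fin !ltrDl !invr_gt0 s0.
by rewrite -!EFinB -EFinM; congr EFin; rewrite !(addrAC _ _ (- _))%R !subrr !add0r -expr2 exprVn.
Qed.

Lemma corner_square_small (s : R) (v : R * R) : (0 < s)%R -> corner_square s 0%R v ->
  (`|v.1| <= s^-1)%R /\ (`|v.2| <= s^-1)%R.
Proof.
move=> s0; rewrite /corner_square /= !subr0 => /andP[/andP[x0 x1] /andP[y0 y1]].
move: x0 y0; rewrite !pmulr_rge0// => x0 y0.
by rewrite !ger0_norm// -[(s^-1)%R]mulr1 !ler_pdivlMl// !ltW.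
Qed.

Lemma corner_square_translate (s : R) P v : corner_square s P (v + P)%R = corner_square s 0%R v.
Proof. by rewrite /corner_square/= !addrK !subr0. Qed.

Section one_set.
Variables (A : set (R * R)) (s : R).
Hypotheses (mA : measurable A).

(** A square based in a tile is of one color up to the deficiency of the tile. *)
Definition deficiency (P : R * R) : \bar R :=
  (\1_A P)%:E * area (corner_square s P `\` A).

Lemma deficiency_ge0 P : 0 <= deficiency P.
Proof. by rewrite mule_ge0// lee_fin. Qed.

Lemma deficiencyE P : deficiency P = \int[area]_v ((\1_A P)%:E *
   ((\1_(corner_square s 0%R) v)%:E * (\1_(~` A) (v + P)%R)%:E)).
Proof.
have mS := @measurable_corner_square R s.
have mD : measurable (corner_square s P `\` A) by exact: measurableD.
rewrite ge0_integralMl; last 3 first.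
- apply: emeasurable_funM; apply/measurable_EFinP.
    by apply: measurable_indic; exact: mS.
  have mi : measurable_fun setT (\1_(~` A) : R * R -> R).
    by apply: measurable_indic; exact: measurableC.
  have mt : measurable_fun setT (fun v : R * R => (v.1 + P.1, v.2 + P.2)%R) by meas.
  exact: (measurableT_comp mi mt).
- by move=> v; rewrite mule_ge0// lee_fin.
- by rewrite lee_fin.
apply: (congr1 (mule _)); rewrite -(integral_indicT area mD).
rewrite (integral_translate P); last 2 first.
- by apply/measurable_EFinP; apply: measurable_indic.
- by move=> X; rewrite lee_fin.
apply: eq_integral => v _; rewrite setDE indicI/= EFinM; congr (EFin _ * _).
by rewrite !indicE; congr ((nat_of_bool _)%:R); apply/idP/idP; rewrite !inE corner_square_translate.
Qed.

Lemma measurable_deficiency_kernel : measurable_fun setT (fun z : (R * R) * (R * R) =>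
  (\1_A z.1)%:E * ((\1_(corner_square s 0%R) z.2)%:E * (\1_(~` A) (z.2 + z.1)%R)%:E) : \bar R).
Proof.
have mS := @measurable_corner_square R s.
have mi : measurable_fun setT (\1_(~` A) : R * R -> R).
  by apply: measurable_indic; exact: measurableC.
have mia : measurable_fun setT (\1_A : R * R -> R) by apply: measurable_indic.
have mis : measurable_fun setT (\1_(corner_square s 0%R) : R * R -> R).
  by apply: measurable_indic; exact: mS.
have mt : measurable_fun setT (fun z : (R * R) * (R * R) => (z.2.1 + z.1.1, z.2.2 + z.1.2)%R) by meas.
apply: emeasurable_funM; first by apply/measurable_EFinP; exact: (measurableT_comp mia measurable_fst).
apply: emeasurable_funM; first by apply/measurable_EFinP; exact: (measurableT_comp mis measurable_snd).
by apply/measurable_EFinP; exact: (measurableT_comp mi mt).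
Qed.

Lemma measurable_deficiency : measurable_fun setT deficiency.
Proof.
rewrite (funext deficiencyE).
apply: measurable_integral => [|P v]; first exact: measurable_deficiency_kernel.
by rewrite !mule_ge0// lee_fin.
Qed.

(** Exchange the base point P and the displacement v inside the square: for fixed
    v, the points P of A that leave A under v form A minus its shift. *)
Lemma integral_deficiency_le (eps : R) : (0 < s)%R -> (0 <= eps)%R ->
  (forall v : R * R, (`|v.1| <= s^-1)%R -> (`|v.2| <= s^-1)%R ->
     area (A `\` shift v A) <= eps%:E) ->
  \int[area]_P deficiency P <= (s ^- 2 * eps)%:E.
Proof.
move=> s0 eps0 hA; have mS := @measurable_corner_square R s.
rewrite (funext deficiencyE) tonelli_plane; last 2 first.
- exact: measurable_deficiency_kernel.
- by move=> P v; rewrite !mule_ge0// lee_fin.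
have -> : (s ^- 2 * eps)%:E = \int[area]_v (eps%:E * (\1_(corner_square s 0%R) v)%:E).
  rewrite ge0_integralMl; last 3 first.
  - by apply/measurable_EFinP; apply: measurable_indic; exact: mS.
  - by move=> v; rewrite lee_fin.
  - by rewrite lee_fin.
  rewrite (_ : \int[area]_v (\1_(corner_square s 0%R) v)%:E = (s ^- 2)%:E); first by rewrite -EFinM mulrC.
  exact: (etrans (integral_indicT area (mS 0%R)) (area_corner_square _ s0)).
apply: le_integralT.
- apply: measurable_integral => [|v P]; last by rewrite !mule_ge0// lee_fin.
  exact: (measurableT_comp measurable_deficiency_kernel (@measurable_swap _ _ _ _)).
- by apply: emeasurable_funM => //; apply/measurable_EFinP; apply: measurable_indic; exact: mS.
- by move=> v; apply: integral_ge0 => P _; rewrite !mule_ge0// lee_fin.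
move=> v; rewrite indicE; have [vS|nS] := boolP (v \in corner_square s 0%R); last first.
    by rewrite mule0 integral0_eq// => P _; rewrite mul0e mule0.
rewrite mule1; have [v1 v2] := corner_square_small s0 (set_mem vS).
apply: le_trans (hA v v1 v2).
have mD : measurable (A `\` shift v A) by apply: measurableD => //; exact: measurable_shift.
rewrite -(integral_indicT area mD) le_eqVlt; apply/orP; left; apply/eqP.
apply: eq_integral => P _; rewrite setDE indicI/= EFinM mul1e.
by congr (_ * _); rewrite !indicE; congr ((nat_of_bool _)%:R%:E); apply/idP/idP; rewrite !inE /shift/= addrC.
Qed.

End one_set.

Section two_colors.
Variables (P M S : set (R * R)) (N s : R).
Hypotheses (mP : measurable P) (mM : measurable M) (mS : measurable S).
Hypotheses (S0 : area S = 0) (PM0 : P `&` M = set0).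
Hypothesis cover : forall x, [\/ S x, P x | M x].

Lemma area_corner_square_setD_fin A P0 : (0 < s)%R -> measurable A ->
  area (corner_square s P0 `\` A) \is a fin_num.
Proof.
move=> s0 mA; rewrite ge0_fin_numE//.
apply: (@le_lt_trans _ _ (area (corner_square s P0))); last by rewrite area_corner_square// ltry.
apply: le_measure; rewrite ?inE; last exact: subDsetl.
- by apply: measurableD => //; exact: measurable_corner_square.
- exact: measurable_corner_square.
Qed.

(** Let p and q be the areas of the two colors in the square. Then p + q = s ^ -2
    and (p - q) ^ 2 = s ^ -4 - 4 p q, and as the tile A has a single color, p or q
    is at most the part of the square outside A. *)
Lemma square_discrepancy_ge (A : set (R * R)) P0 : (0 < s)%R -> measurable A ->
  corner_square s P0 `<=` big_square N -> A `<=` P \/ A `<=` M ->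
  ((s ^- 2) ^+ 2 <=
    (square_mass (P `&` big_square N) (s, P0) - square_mass (M `&` big_square N) (s, P0)) ^+ 2 +
    4 * s ^- 2 * fine (area (corner_square s P0 `\` A)))%R.
Proof.
move=> s0 mA sqN AC; have msq := @measurable_corner_square R s P0.
have cE C : square_mass (C `&` big_square N) (s, P0) = fine (area (corner_square s P0 `&` C)).
  rewrite /square_mass/=; congr (fine (area _)).
  apply/seteqP; split => x.
    by move=> [[Cx _] sx]; split.
  by move=> [sx Cx]; split => //; split => //; exact: sqN.
have sub C : measurable C -> area (corner_square s P0 `&` C) \is a fin_num.
  by move=> mC; rewrite -[C]setCK -setDE; apply: area_corner_square_setD_fin => //; exact: measurableC.
have mI C : measurable C -> measurable (corner_square s P0 `&` C) by move=> mC; exact: measurableI.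
rewrite !cE; set p := fine _; set q := fine (area (_ `&` M)); set d := fine (area (_ `\` A)).
have p0 : (0 <= p)%R by exact: fine_ge0.
have q0 : (0 <= q)%R by exact: fine_ge0.
have d0 : (0 <= d)%R by exact: fine_ge0.
have finD := area_corner_square_setD_fin P0 s0 mA.
have mD : measurable (corner_square s P0 `\` A) by exact: measurableD.
have pq : (p + q = s ^- 2)%R.
  apply: EFin_inj; rewrite -(area_corner_square P0 s0) EFinD !fineK ?sub//.
  rewrite -measureU; try exact: mI; last first.
    by rewrite setIACA PM0 setI0.
  rewrite -setIUr; apply/eqP; rewrite eq_le; apply/andP; split.
    apply: le_measure; rewrite ?inE; [|exact: msq|exact: subIsetl].
    by apply: mI; exact: measurableU.
  have mU : measurable (corner_square s P0 `&` (P `|` M)) by apply: mI; exact: measurableU.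
  rewrite -[leRHS]adde0 -S0; apply: le_trans (measureU2 area mU mS).
  apply: le_measure; rewrite ?inE; [exact: msq|exact: measurableU|].
  by move=> x sx; have [?|?|?] := cover x; [right|left; split=> //; left|left; split=> //; right].
have disj x : P x -> M x -> False.
  by move=> Px Mx; have : (P `&` M) x by []; rewrite PM0.
have : (p <= d \/ q <= d)%R.
  case: AC => AC; [right|left]; (apply: fine_le; [exact: sub|exact: finD|]);
    apply: le_measure; rewrite ?inE; [exact: mI|exact: mD| |exact: mI|exact: mD|].
    by move=> x [sx Mx]; split=> // /AC Px; exact: (disj x).
  by move=> x [sx Px]; split=> // /AC Mx; exact: (disj x).
have s2 : (0 <= s ^- 2)%R by rewrite invr_ge0 sqr_ge0.
rewrite -pq in s2 *; case=> h; nra.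
Qed.

Variables (C : set (R * R)) (L : seq (R * R)) (eps : R).
Hypothesis (mC : measurable C).
Hypothesis colorL : forall t, t \in L -> shift (- t)%R C `<=` P \/ shift (- t)%R C `<=` M.
Hypothesis coverL : forall x, big_square N x -> S x \/ exists2 t, t \in L & shift (- t)%R C x.
Hypothesis epsC : forall v : R * R, (`|v.1| <= s^-1)%R -> (`|v.2| <= s^-1)%R ->
     area (C `\` shift v C) <= eps%:E.

(** Base points are taken in the big square of half-side N / 2, so that their
    squares stay inside the one of half-side N. Each base point off S lies in one of the
    tiles listed by L, and the total loss is the sum of their mean deficiencies. *)
Lemma square_energy_ge : (1 <= s)%R -> (2 <= N)%R -> (0 <= eps)%R ->
  (s ^- 4 * (N ^+ 2 - 4 * (size L)%:R * eps))%:E <=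
  \int[area]_P0 ((square_mass (P `&` big_square N) (s, P0) - square_mass (M `&` big_square N) (s, P0)) ^+ 2)%:E.
Proof.
move=> s1 N2 eps0; have s0 : (0 < s)%R by exact: lt_le_trans s1.
have N0 : (0 < N)%R by exact: lt_le_trans N2.
set F := fun P0 => (square_mass (P `&` big_square N) (s, P0) - square_mass (M `&` big_square N) (s, P0))%R.
pose G P0 := \sum_(t <- L) ((4 * s ^- 2)%:E * deficiency (shift (- t)%R C) s P0).
have c0 : (0 <= 4 * s ^- 2)%R by rewrite mulr_ge0// invr_ge0 sqr_ge0.
have mbs := @measurable_big_square R N.
have mF : measurable_fun setT F.
  have mpair : measurable_fun setT (fun P0 : R * R => (s, P0)) by meas.
  have mcell B : measurable B -> measurable_fun setT (square_mass (B `&` big_square N)).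
    by move=> mB; apply: (measurable_square_mass (measurableI _ _ mB mbs) _ N0) => x [].
  by apply: measurable_funB; apply: (measurableT_comp (mcell _ _) mpair).
have mCt t : measurable (shift (- t)%R C) by exact: measurable_shift.
have mdef t : measurable_fun setT (fun P0 => (4 * s ^- 2)%:E * deficiency (shift (- t)%R C) s P0).
  by apply: emeasurable_funM => //; exact: measurable_deficiency.
have def0 t P0 : 0 <= (4 * s ^- 2)%:E * deficiency (shift (- t)%R C) s P0.
  by rewrite mule_ge0 ?deficiency_ge0.
have G0 P0 : 0 <= G P0 by apply: sume_ge0 => t _; exact: def0.
have mG : measurable_fun setT G by apply: emeasurable_sum => t; exact: mdef.
have intG : \int[area]_P0 G P0 <= (s ^- 4 * (4 * (size L)%:R * eps))%:E.
  rewrite /G ge0_integral_sum//.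
  apply: (@le_trans _ _ (\sum_(t <- L) (4 * s ^- 2 * (s ^- 2 * eps))%:E)).
    apply: lee_sum => t _.
    rewrite ge0_integralMl; last 3 first.
    - exact: measurable_deficiency.
    - by move=> P0; exact: deficiency_ge0.
    - by rewrite lee_fin.
    rewrite [leRHS]EFinM; apply: lee_wpmul2l; first by rewrite lee_fin.
    apply: integral_deficiency_le => // v v1 v2.
    rewrite (_ : _ `\` _ = shift (- t)%R (C `\` shift v C)).
      rewrite [leLHS]measure_shift; first exact: epsC.
      by apply: measurableD => //; exact: measurable_shift.
    by apply/seteqP; split => x; rewrite /shift/= addrAC.
  rewrite sumEFin big_const_seq count_predT iter_addr_0 lee_fin -mulr_natl.
  rewrite le_eqVlt; apply/orP; left; apply/eqP.
  by rewrite -exprVn -[(s ^- 4)%R]exprVn; ring.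
have mhalf := @measurable_big_square R (N / 2).
have key : (s ^- 4 * N ^+ 2)%:E <= \int[area]_P0 ((F P0 ^+ 2)%:E + G P0).
  have -> : (s ^- 4 * N ^+ 2)%:E = \int[area]_P0 ((s ^- 4)%:E * (\1_(big_square (N / 2)) P0)%:E).
    rewrite ge0_integralMl; last 3 first.
    - by apply/measurable_EFinP; apply: measurable_indic.
    - by move=> P0; rewrite lee_fin.
    - by rewrite lee_fin invr_ge0 exprn_ge0// ltW.
    rewrite (_ : \int[area]_P0 _ = (N ^+ 2)%:E) ?EFinM//.
    have N20 : (0 <= N / 2)%R by rewrite divr_ge0// ltW.
    apply: etrans (integral_indicT area mhalf) (etrans (area_big_square N20) _).
    by congr EFin; field.
  apply: ae_ge0_le_integral.
  - exact: measurableT.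
  - by move=> P0 _; rewrite mule_ge0// lee_fin invr_ge0 exprn_ge0// ltW.
  - by apply: emeasurable_funM => //; apply/measurable_EFinP; apply: measurable_indic.
  - by move=> P0 _; rewrite adde_ge0// lee_fin sqr_ge0.
  - apply: emeasurable_funD => //; apply/measurable_EFinP.
    exact: measurable_funX.
  exists S; split => // P0 /= /not_implyP[_]; apply: contra_notP => nS.
  rewrite indicE; have [/set_mem Ph|_] := boolP (P0 \in _); last first.
    by rewrite mule0 adde_ge0// lee_fin sqr_ge0.
  have PN : big_square N P0.
    by case: Ph => h1 h2; split; [apply: le_trans h1 _|apply: le_trans h2 _]; lra.
  have [//|[t tL Ct]] := coverL PN.
  have sqN : corner_square s P0 `<=` big_square N.
    move=> X; rewrite -[X](subrK P0) corner_square_translate => /(corner_square_small s0)[h1 h2].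
    have si : (s^-1 <= 1)%R by rewrite invf_le1.
    case: Ph => k1 k2; split => /=.
      by rewrite (le_trans (ler_normD _ _))//; lra.
    by rewrite (le_trans (ler_normD _ _))//; lra.
  have := square_discrepancy_ge s0 (mCt t) sqN (colorL tL).
  rewrite -lee_fin mule1 => h; apply: le_trans (le_trans h _).
    by rewrite lee_fin -!exprVn -exprM.
  rewrite EFinD leeD2l//.
  have -> : (4 * s ^- 2 * fine (area (corner_square s P0 `\` shift (- t)%R C)))%:E =
     (4 * s ^- 2)%:E * deficiency (shift (- t)%R C) s P0.
    rewrite /deficiency indicE mem_set// mul1e EFinM fineK//.
    exact: area_corner_square_setD_fin.
  rewrite /G (big_rem t)//=; apply: leeDl; apply: sume_ge0 => u _; exact: def0.
rewrite mulrBr EFinB; rewrite leeBlDr//.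
apply: le_trans key _; rewrite ge0_integralD//; last 2 first.
- by move=> P0 _; rewrite lee_fin sqr_ge0.
- by apply/measurable_EFinP; exact: measurable_funX.
by rewrite leeD2l.
Qed.
End two_colors.
End deficiency.

(** * Comparison of the two bounds *)

Section final.
Context {R : realType}.
Notation mu := (@lebesgue_measure R).
Notation area := (sf_prod mu mu).
Notation scaled_area := (sf_prod mu area).

(** The weight s ^ 2 meets the lower bound s ^ -4 B, leaving at least
    B / (4 s0 ^ 2) on an interval of length s0. *)
Lemma square_energy_all_scales (F : R * (R * R) -> R) (s0 B : R) :
  measurable_fun setT F -> 0 < s0 -> 0 <= B ->
  (forall s, s0 <= s <= 2 * s0 -> ((s ^- 4 * B)%:E <= \int[area]_P ((F (s, P)) ^+ 2)%:E)%E) ->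
  ((B / (4 * s0))%:E <=
    \int[scaled_area]_w (pos_ind w.1 * (w.1 ^+ 2)%:E * ((F w) ^+ 2)%:E))%E.
Proof.
move=> mF s00 B0 hF; have mp := @measurable_pos_ind R.
have w0 (s : R) : (0 <= pos_ind s * (s ^+ 2)%:E)%E.
  by apply: mule_ge0; [exact: pos_ind_ge0|rewrite lee_fin sqr_ge0].
rewrite integral_product_iter; last 2 first.
- by meas.
- by move=> w; rewrite mule_ge0// lee_fin sqr_ge0.
pose I := `[s0, (2 * s0)]%classic.
have mI : measurable I by exact: measurable_itv.
have -> : (B / (4 * s0))%:E = (\int[mu]_s ((B / (4 * s0 ^+ 2))%:E * (\1_I s)%:E))%E.
  rewrite ge0_integralMl; last 3 first.
  - by apply/measurable_EFinP; apply: measurable_indic.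
  - by move=> s; rewrite lee_fin.
  - by rewrite lee_fin divr_ge0// mulr_ge0// sqr_ge0.
  rewrite (_ : (\int[mu]_s (\1_I s)%:E = s0%:E)%E).
    by rewrite -EFinM; congr EFin; field; rewrite gt_eqF.
  apply: etrans (integral_indicT mu mI) _; rewrite [LHS]mu_interval.
  by rewrite max_l; [congr EFin; ring|lra].
apply: le_integralT.
- by apply: emeasurable_funM => //; apply/measurable_EFinP; apply: measurable_indic.
- apply: measurable_integral => [|s P]; last by rewrite mule_ge0// lee_fin sqr_ge0.
  have mpair : measurable_fun setT (fun z : R * (R * R) => (z.1, z.2)) by meas.
  by meas.
- by move=> s; rewrite mule_ge0// lee_fin divr_ge0// mulr_ge0// sqr_ge0.
move=> s /=; rewrite indicE; have [/set_mem sI|_] := boolP (s \in I); last first.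
  by rewrite mule0 integral_ge0// => P _; rewrite mule_ge0// lee_fin sqr_ge0.
move: sI; rewrite /I/= in_itv/= => sI; have /andP[s1 s2] := sI.
have sp : 0 < s by exact: lt_le_trans s1.
rewrite mule1 ge0_integralMl; last 3 first.
- have mpair : measurable_fun setT (fun P : R * R => (s, P)) by meas.
  by apply/measurable_EFinP; apply: measurable_funX; exact: (measurableT_comp mF mpair).
- by move=> P; rewrite lee_fin sqr_ge0.
- exact: w0.
apply: le_trans (lee_wpmul2l (w0 s) (hF s sI)).
rewrite pos_indE sp mul1e -EFinM lee_fin.
have -> : s ^+ 2 * (s ^- 4 * B) = s ^- 2 * B by field; rewrite gt_eqF.
rewrite mulrC; apply: ler_wpM2r => //.
have s2p : 0 < s ^+ 2 by exact: exprn_gt0.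
have t2p : 0 < 4 * s0 ^+ 2 by rewrite mulr_gt0// exprn_gt0.
rewrite lef_pV2 ?posrE// (_ : 4 * s0 ^+ 2 = (2 * s0) ^+ 2); last by ring.
by rewrite lerXn2r// nnegrE; lra.
Qed.

Lemma bounded_in_square (Q : set (R * R)) : bounded_set Q ->
  exists2 K : R, 0 < K & Q `<=` big_square K.
Proof.
move=> bQ; have [K K0 QK] := ex_strict_bound_gt0 bQ.
exists K => // x Qx; have : Num.max `|x.1| `|x.2| < K by exact: QK.
rewrite gt_max => /andP[h1 h2].
by split; exact: ltW.
Qed.

(** The coordinates of these points in the basis are O (N) by
    [lattice_point_coordinates], so there are O (N ^ 2) of them. *)
Lemma lattice_points_list (a b : R * R) (T : set (R * R)) (K : R) :
  zbasis T a b -> parallelogram_area a b = 1 ->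
  exists2 k : R, 0 < k & forall N : R, 1 <= N -> K <= N -> exists L : seq (R * R),
    [/\ (size L)%:R <= k * N ^+ 2, (forall t, t \in L -> T t) &
      forall t, T t -> `|t.1| <= N + K -> `|t.2| <= N + K -> t \in L].
Proof.
move=> [TE _] ab; set c := `|a.1| + `|a.2| + `|b.1| + `|b.2|.
have c0 : 0 <= c by rewrite !addr_ge0.
exists ((4 * c + 3) ^+ 2) => [|N N1 KN]; first by rewrite exprn_gt0//; lra.
pose h := (Num.truncn (2 * N * c)).+1.
have Nc0 : 0 <= 2 * N * c by rewrite !mulr_ge0//; lra.
have h1 : 2 * N * c < h%:R by exact: truncnS_gt.
have h2 : h%:R <= 2 * N * c + 1.
  by rewrite /h -addn1 natrD lerD2r; have := truncn_itv Nc0 => /andP[].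
(* Coordinates between - h and h are shifted to be natural numbers. *)
pose pt (i j : nat) : R * R := a *~ (i%:Z - h%:Z) + b *~ (j%:Z - h%:Z).
exists [seq pt i j | i <- iota 0 (2 * h + 1), j <- iota 0 (2 * h + 1)]; split.
- rewrite size_allpairs size_iota natrM -expr2 -exprMn lerXn2r ?nnegrE//.
    by rewrite mulr_ge0//; lra.
  rewrite natrD natrM.
  have : 0 <= N - 1 by lra.
  by move: h2 c0; nra.
- by move=> t /allpairsP[[i j] [_ _ ->]]; rewrite TE; exists (i%:Z - h%:Z), (j%:Z - h%:Z).
move=> t; rewrite TE => -[m [n ->]] t1 t2.
have [m1 n1] := lattice_point_coordinates ab t1 t2.
have idx (p : int) : `|p%:~R : R| <= (N + K) * c ->
    exists2 i : nat, i \in iota 0 (2 * h + 1) & i%:Z - h%:Z = p.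
  move=> pc; have ph : `|p| < h%:Z.
    rewrite -(ltr_int R) intr_norm; apply: le_lt_trans pc _; apply: le_lt_trans h1.
    by rewrite ler_wpM2r//; lra.
  exists (absz (p + h%:Z)).
    by rewrite mem_iota; move: ph; clear; lia.
  by move: ph; clear; lia.
have [i iI <-] := idx m m1; have [j jI <-] := idx n n1.
by apply/allpairsP; exists (i, j).
Qed.

End final.

Local Notation area R := (sf_prod (@lebesgue_measure R) (@lebesgue_measure R)).
Local Notation scaled_area R := (sf_prod (@lebesgue_measure R) (area R)).

Theorem corollary1 (R : realType) (T Q : set (R * R)) :
  lattice T -> has_area T 1 ->
  bounded_set Q -> lebesgue_measurable2 Q -> fundamental_domain T Q ->
  exists C : R, 0 < C /\
    forall z : R * R -> R, (forall t, T t -> z t = -1 \/ z t = 1) ->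
    forall l : R, 0 < l ->
    exists a b : R * R,
      [/\ l <= seg_length a b,
          measurable_on_line (coloring T Q z) a b &
          C * Num.sqrt (seg_length a b)
            <= `|seg_integral (coloring T Q z) a b| ].
Proof.
move=> [T0 TB _ _] [a [b [Tab ab]]] bQ lQ fQ.
have [K K0 QK] := bounded_in_square bQ.
have [C [Z [mC mZ Z0 CQ QCZ]]] := borel_core lQ.
have [e Te] := zbasis_enum Tab.
have [k k0 points] := lattice_points_list K Tab ab.
(* There are at most k N ^ 2 tiles, and 4 k N ^ 2 eps is half of N ^ 2. *)
pose eps := (8 * k)^-1.
have eps0 : 0 < eps by rewrite invr_gt0 mulr_gt0.
have [_ /(_ K eps K0 eps0)[d [/andP[d0 d1] dC]]] := translation_continuity mC.
have pi0 : 0 < (pi : R) := pi_gt0 R.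
(* With C ^ 2 = d / (256 pi), the part 16 pi C ^ 2 N ^ 2 of the upper bound is half
   of the lower bound d N ^ 2 / 8; the last summand of N below makes the other half
   exceed the remaining 4 pi l ^ 2 N. *)
pose Cst := Num.sqrt (d / (16 * 16 * pi)).
have c0 : 0 < d / (16 * 16 * pi) by rewrite divr_gt0// !mulr_gt0.
have Cst0 : 0 < Cst by rewrite sqrtr_gt0.
have CstE : Cst ^+ 2 = d / (16 * 16 * pi) by rewrite sqr_sqrtr// ltW.
exists Cst; split=> // z z1 l l0; apply: contrapT => none.
have small p q : l <= seg_length p q -> measurable_on_line (coloring T Q z) p q ->
    `|seg_integral (coloring T Q z) p q| < Cst * Num.sqrt (seg_length p q).
  by move=> lpq mpq; rewrite ltNge; apply/negP => h; apply: none; exists p, q.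
pose P := tiles T C z 1; pose M := tiles T C z (-1); pose S := seams T Z.
have mP : measurable P by exact: (measurable_tiles z Te mC).
have mM : measurable M by exact: (measurable_tiles z Te mC).
have mS : measurable S by exact: (measurable_seams Te mZ).
have S0 : area R S = 0%E by exact: (seams_null Te mZ Z0).
have fPM x : ~ S x -> coloring T Q z x = \1_P x - \1_M x.
  exact: (coloring_tiles T0 TB fQ CQ QCZ z1).
have PM0 : P `&` M = set0 by exact: (tiles_disjoint z T0 TB fQ CQ).
have cover x : [\/ S x, P x | M x] by exact: (seams_or_tiles T0 TB fQ QCZ z1).
pose N := 2 + K + 64 * pi * l ^+ 2 / d.
have r0 : 0 < 64 * pi * l ^+ 2 / d by rewrite divr_gt0// !mulr_gt0// exprn_gt0.
have N2 : 2 <= N by rewrite /N; lra.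
have N0 : 0 < N by lra.
have N1 : 1 <= N by lra.
have KN : K <= N by rewrite /N; lra.
have [L [sizeL LT Lall]] := points N N1 KN.
have upper := line_energy_le mP mM mS S0 fPM N0 (ltW Cst0) small.
have lower : ((N ^+ 2 / 2 / (4 * d^-1))%:E <= \int[scaled_area R]_w (pos_ind w.1 * (w.1 ^+ 2)%:E *
    ((square_mass (P `&` big_square N) w - square_mass (M `&` big_square N) w) ^+ 2)%:E))%E.
  have mbs := @measurable_big_square R N.
  apply: (square_energy_all_scales (F := fun w => _ w - _ w)).
  - apply: measurable_funB.
    + by apply: (measurable_square_mass (measurableI _ _ mP mbs) _ N0) => x [].
    + by apply: (measurable_square_mass (measurableI _ _ mM mbs) _ N0) => x [].
  - by rewrite invr_gt0.
  - by rewrite divr_ge0// sqr_ge0.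
  move=> s /andP[s1 s2].
  have s0 : 0 < s by apply: lt_le_trans s1; rewrite invr_gt0.
  have s_ge1 : 1 <= s by apply: le_trans s1; rewrite invf_ge1.
  have sd : s^-1 <= d by rewrite -[leRHS]invrK lef_pV2 ?posrE// invr_gt0.
  have colorL t : t \in L -> shift (- t) C `<=` P \/ shift (- t) C `<=` M.
    by move=> /LT Tt; have [zt|zt] := z1 t Tt; [right|left] => x Cx; exists t.
  have coverL x : big_square N x -> S x \/ exists2 t, t \in L & shift (- t) C x.
    move=> [x1 x2]; have [?|[t Tt Ct]] := seams_or_tile T0 TB fQ QCZ x; first by left.
    right; exists t => //; have [c1 c2] := QK _ (CQ _ Ct); apply: Lall => //.
      rewrite (_ : t.1 = x.1 - (x - t).1); last by rewrite /= subKr.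
      by rewrite (le_trans (ler_normB _ _))// lerD.
    rewrite (_ : t.2 = x.2 - (x - t).2); last by rewrite /= subKr.
    by rewrite (le_trans (ler_normB _ _))// lerD.
  have epsC (v : R * R) : `|v.1| <= s^-1 -> `|v.2| <= s^-1 -> (area R (C `\` shift v C) <= eps%:E)%E.
    move=> v1 v2; apply: le_trans (dC v (le_trans v1 sd) (le_trans v2 sd)).
    apply: le_measure; rewrite ?inE.
    - by apply: measurableD => //; exact: measurable_shift.
    - exact: measurable_shiftY.
    - by move=> x [Cx nx]; split; [exact: QK (CQ _ Cx)|left].
  apply: le_trans (square_energy_ge mP mM mS S0 PM0 cover mC colorL coverL epsC s_ge1 N2 (ltW eps0)).
  rewrite lee_fin ler_wpM2l// ?invr_ge0 ?exprn_ge0 ?(ltW s0)//.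
  have : 4 * (size L)%:R * eps <= N ^+ 2 / 2.
    rewrite /eps ler_pdivrMr ?mulr_gt0//.
    by move: sizeL; nra.
  lra.
have PN : P `&` big_square N `<=` big_square N by move=> x [].
have MN : M `&` big_square N `<=` big_square N by move=> x [].
have mbs := @measurable_big_square R N.
rewrite -(line_square_identity (measurableI _ _ mP mbs) (measurableI _ _ mM mbs) PN MN N0) in lower.
have := le_trans lower upper; rewrite lee_fin CstE.
have -> : N ^+ 2 / 2 / (4 * d^-1) = N * (N * d / 8) by field; rewrite gt_eqF.
set u := d / _; have uE : d = u * (16 * 16 * pi) by rewrite divfK// gt_eqF// !mulr_gt0.
have -> : 4 * N * (l ^+ 2 + 4 * u * N) * pi = N * (4 * pi * l ^+ 2 + N * d / 16).
  by rewrite [in RHS]uE; field.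
rewrite ler_pM2l//.
have : 64 * pi * l ^+ 2 < N * d.
  by rewrite -ltr_pdivrMr// /N; lra.
lra.
Qed.
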